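(* Let $Q$ be the source-sink quiver of type $A_{2m}$, with vertices $s_1,\dots,s_{2m}$ and arrows $a_{2i-1}:s_{2i-1}\to s_{2i}$ for $1\le i\le m$ and $a_{2i}:s_{2i+1}\to s_{2i}$ for $1\le i\le m-1$. Let $V_1,\dots,V_{2m}$ be complex vector spaces of dimensions $d_1,\dots,d_{2m}$ and let $\mathcal R_d$ be the space of representations of $Q$ on them. Let $r=(r_1,\dots,r_{2m-1})$, $p=(p_1,\dots,p_{m-1})$, $q=(q_1,\dots,q_{m-1})$ be integer vectors, and let $\overline{\mathcal O}_{r,p,q}$ be the closure of the orbit $\mathcal O_{r,p,q}$ of $\phi\in\mathcal R_d$ with $$\dim\mathrm{Im}\,\phi_{a_i}=r_i\ (1\le i\le 2m-1),\quad \dim(\mathrm{Im}\,\phi_{a_{2i-1}}+\mathrm{Im}\,\phi_{a_{2i}})=p_i\ (1\le i\le m-1),$$ $$\dim(\ker\phi_{a_{2i+1}}\cap\ker\phi_{a_{2i}})=q_i\ (1\le i\le m-1).$$ Assume $p_i\neq r_{2i-1},r_{2i}$ and $q_i\neq d_{2i+1}-r_{2i+1},\,d_{2i+1}-r_{2i}$ for $1\le i\le m-1$. Then the resolution of singularities of $\overline{\mathcal O}_{r,p,q}$ defined by $W,F$ (see the context) is crepant if and only if $$d_1=d_{2m}=p_i\ (1\le i\le m-1),\qquad q_i=d_{2i+1}-d_1\ (1\le i\le m-1),\qquad r_i=d_{i+1}-r_{i+1}\ (1\le i\le 2m-2).$$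
   Context: $\mathrm{Gr}(\alpha,V_i)$ is the Grassmannian of $\alpha$-dimensional subspaces of $V_i$, and $F(\alpha_1,\alpha_2,V_i)$ is the flag variety in $V_i$ with tautological bundles $\mathcal U_{i,1}\subset\mathcal U_{i,2}$ of ranks $\alpha_1,\alpha_2$. On $\mathrm{Gr}(d_1-r_1,V_1)$ the tautological bundle is denoted $\mathcal U_{1,2}$. Bundles are pulled back to products. $\mathcal R_d=\bigoplus_a\mathrm{Hom}(V_{a(0)},V_{a(1)})$, the sum being over the arrows $a$, with $a(0)$ the source and $a(1)$ the target of $a$. The resolution of $\overline{\mathcal O}_{r,p,q}$ is the total space of $$W=((V_{2m-1}/\mathcal U_{2m-1,2})^*\otimes V_{2m})\oplus\bigoplus_{i=1}^{m-1}\Big(((V_{2i-1}/\mathcal U_{2i-1,2})^*\otimes\mathcal U_{2i,2})\oplus((V_{2i+1}/\mathcal U_{2i+1,1})^*\otimes\mathcal U_{2i,1})\Big)$$ over $$F=\mathrm{Gr}(d_1-r_1,V_1)\times\prod_{i=1}^{m-1}\big(F(r_{2i},p_i,V_{2i})\times F(q_i,d_{2i+1}-r_{2i+1},V_{2i+1})\big),$$ viewed as a subbundle of the trivial bundle $\mathcal R_d\times F$ and mapped to $\mathcal R_d$ by projection. The resolution is crepant if $\det(W)\cong K_F$ as line bundles on $F$ (equivalently, the total space of $W$ has trivial canonical bundle).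
   Formalization: ''Crepant implies the equalities'' is stated only if no tautological subbundle is 0 or all of V_i (0<r_1<d_1, p_i<d_{2i}, q_i>0); it fails otherwise, e.g. d=(3,3,3,3), r=(2,2,1), p_1=3, q_1=0. The converse is stated without this restriction. *)

(* Defs.v *)
From HB Require Import structures.
From mathcomp Require Import all_boot all_order all_algebra.
From mathcomp Require Import boolp classical_sets reals.
From mathcomp Require Import mxtens complex mpoly.

Set Implicit Arguments.
Unset Strict Implicit.
Unset Printing Implicit Defensive.

Import GRing.Theory.
Local Open Scope ring_scope.

(** * Smooth varieties covered by affine spaces

    A smooth variety of dimension [coords] is given by its points and an open
    cover by affine spaces: [param c] is the inverse of a chart, an injective
    map from the affine space K^coords onto the open subset indexed by [c].
    Regular functions on such an open subset are polynomials in the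
    coordinates. *)

Record atlas (K : fieldType) := Atlas {
  coords : nat;
  point : Type;
  cell : Type;
  param : cell -> 'rV[K]_coords -> point
}.

Section Bundles.
Variables (K : fieldType) (X : atlas K).
Local Notation N := (coords X).

Definition poly_value (P : {mpoly K[N]}) (z : 'rV[K]_N) : K :=
  P.@[fun i => z 0 i].

(** [v] is the partial derivative at [z], with respect to the coordinate [l],
    of a function [f] which is regular near [z], i.e., equal to a quotient of
    polynomials [P / Q] on the principal open neighbourhood [Q != 0] of [z]. *)
Definition is_partial (f : 'rV[K]_N -> K) (z : 'rV[K]_N) (l : 'I_N) (v : K) :=
  exists P Q : {mpoly K[N]},
    [/\ poly_value Q z != 0,
        forall y, poly_value Q y != 0 -> f y = poly_value P y / poly_value Q y
      & v = (poly_value P^`M(l) z * poly_value Q z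
             - poly_value P z * poly_value Q^`M(l) z) / poly_value Q z ^+ 2].

Definition partial (f : 'rV[K]_N -> K) (z : 'rV[K]_N) (l : 'I_N) : K :=
  xget 0 [set v | is_partial f z l v].

(** The change of coordinates from the chart [c] to the chart [c'] (with the
    value 0 outside the overlap). *)
Definition change_coords (c c' : cell X) (z : 'rV[K]_N) : 'rV[K]_N :=
  xget 0 [set z' | param c z = param c' z'].

Definition jacobian (c c' : cell X) (z : 'rV[K]_N) : 'M[K]_N :=
  \matrix_(l, k) partial (fun y => change_coords c c' y 0 k) z l.

(** Vector bundles are given by transition matrices: every chart [c] carries a
    frame [e_c] (a column of [rank E] sections), and
    [e_c = trans E c c' z z' *m e_c'] at the point [param c z = param c' z'].
    The value of [trans E c c' z z'] is irrelevant when [param c z] and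
    [param c' z'] differ. *)
Record vbundle := VBundle {
  rank : nat;
  trans : cell X -> cell X -> 'rV[K]_N -> 'rV[K]_N -> 'M[K]_rank
}.

Definition trivial_bundle (k : nat) : vbundle :=
  @VBundle k (fun _ _ _ _ => 1%:M).

Definition dual_bundle (E : vbundle) : vbundle :=
  @VBundle (rank E) (fun c c' z z' => (invmx (trans E c c' z z'))^T).

Definition tensor_bundle (E E' : vbundle) : vbundle :=
  @VBundle (rank E * rank E')%N
    (fun c c' z z' => trans E c c' z z' *t trans E' c c' z z').

Definition sum_bundle (E E' : vbundle) : vbundle :=
  @VBundle (rank E + rank E')%N
    (fun c c' z z' => block_mx (trans E c c' z z') 0 0 (trans E' c c' z z')).

(** The frame of the chart [c] consists of the coordinate vector fields. *)
Definition tangent_bundle : vbundle :=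
  @VBundle N (fun c c' z _ => jacobian c c' z).

(** Line bundles, with the same convention. *)
Definition lbundle : Type :=
  cell X -> cell X -> 'rV[K]_N -> 'rV[K]_N -> K.

Definition det_bundle (E : vbundle) : lbundle :=
  fun c c' z z' => \det (trans E c c' z z').

Definition canonical_bundle : lbundle := det_bundle (dual_bundle tangent_bundle).

(** An isomorphism sends the frame of [L] over the chart [c] to [h c] times the
    frame of [L'], where [h c] is regular and nowhere zero on the chart. *)
Definition lbundle_iso (L L' : lbundle) : Prop :=
  exists h : cell X -> {mpoly K[N]},
    (forall c z, poly_value (h c) z != 0) /\
    (forall c c' z z', param c z = param c' z' ->
       poly_value (h c) z * L' c c' z z' = L c c' z z' * poly_value (h c') z').

End Bundles.

Arguments trivial_bundle {K X} k.
Arguments tangent_bundle {K} X.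
Arguments canonical_bundle {K} X.

Lemma basis_exists (K : fieldType) m (s t : nat) (A B : 'M[K]_m) :
  \rank A = s -> \rank B = t -> (A <= B)%MS ->
  exists2 g : 'M[K]_m, g \in unitmx &
    ((pid_mx s : 'M_m) *m g :=: A)%MS /\ ((pid_mx t : 'M_m) *m g :=: B)%MS.
Proof.
move=> rA rB AB.
have [k mE] : exists k, m = (t + k)%N.
  by exists (m - t)%N; rewrite subnKC // -rB rank_leq_row.
move: A B rA rB AB; rewrite {}mE => A B rA rB AB.
have pidB : ((pid_mx t : 'M_(t + k)) *m row_ebase B :=: B)%MS.
  apply/eqmxP; rewrite -{2 3}(mulmx_ebase B) rB -mulmxA; apply/eqmxP.
  by apply/eqmx_sym/eqmxMfull; rewrite row_full_unit col_ebase_unit.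
have /submxP[X AE] : (A <= (pid_mx t : 'M_(t + k)) *m row_ebase B)%MS.
  by rewrite pidB.
pose Y : 'M_(_, t) := lsubmx X.
have XE : X *m pid_mx t = row_mx Y 0 :> 'M_(_, t + k).
  by rewrite -[X]hsubmxK pid_mx_block mul_row_block !mulmx0 mulmx1 !addr0.
have AE' : A = row_mx Y 0 *m row_ebase B by rewrite AE mulmxA XE.
have rY : \rank Y = s.
  rewrite -rA AE' mxrankMfree ?row_free_unit ?row_ebase_unit //.
  by rewrite rank_row_mx0.
have st : (s <= t)%N by rewrite -rY rank_leq_col.
pose h : 'M_(t + k) := block_mx (row_ebase Y) 0 0 1%:M.
exists (h *m row_ebase B).
  by rewrite unitmx_mul row_ebase_unit andbT unitmxE det_ublock det1 mulr1 -unitmxE row_ebase_unit.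
have hu : h \in unitmx by rewrite unitmxE det_ublock det1 mulr1 -unitmxE row_ebase_unit.
split.
  rewrite AE' mulmxA; apply: eqmxMr.
  have -> : pid_mx s = block_mx (pid_mx s) 0 0 0 :> 'M[K]_(t + k).
    apply/matrixP => i j; rewrite !mxE.
    case: splitP => i' ->; rewrite !mxE; case: splitP => j' ->; rewrite !mxE //.
    - by case: eqP => //= E; move: (ltn_ord i'); rewrite E ltnNge leq_addr.
    - by rewrite [(_ < s)%N]ltnNge (leq_trans st) ?leq_addr ?andbF.
    - by rewrite [(_ < s)%N]ltnNge (leq_trans st) ?leq_addr ?andbF.
  rewrite mulmx_block !mul0mx !mulmx0 !addr0.
  have -> A' : block_mx A' 0 0 0 = col_mx 1%:M 0 *m row_mx A' 0 :> 'M[K]_(t + k).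
    by rewrite mul_col_row !mul0mx !mul1mx.
  apply: (@eqmx_trans _ _ _ _ _ _ (row_mx (pid_mx s *m row_ebase Y) 0)).
    by apply: eqmxMfull; rewrite -col_leq_rank -mxrank_tr tr_col_mx trmx1 trmx0 rank_row_mx0 mxrank1.
  have rE m' (A' : 'M[K]_(m', t)) : row_mx A' 0 = A' *m row_mx 1%:M 0 :> 'M_(m', t + k).
    by rewrite mul_mx_row mulmx1 mulmx0.
  rewrite rE [X in (_ :=: X)%MS]rE; apply: eqmxMr.
  apply/eqmxP; rewrite -{2 3}(mulmx_ebase Y) rY -mulmxA; apply/eqmxP.
  apply: (@eqmx_trans _ _ _ _ _ _ ((pid_mx s : 'M_(t + k, t)) *m row_ebase Y)).
    apply: eqmxMr; apply/eqmxP/andP; split.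
      rewrite (_ : pid_mx s = (pid_mx s : 'M[K]_(t, t + k)) *m (pid_mx s : 'M_(t + k, t))) ?submxMl //.
      by rewrite mul_pid_mx minnn (minn_idPr (leq_trans st (leq_addr _ _))).
    rewrite (_ : (pid_mx s : 'M_(t + k, t)) = (pid_mx s : 'M[K]_(t + k, t)) *m (pid_mx s : 'M_t)) ?submxMl //.
    by rewrite mul_pid_mx minnn (minn_idPr st).
  by apply/eqmx_sym/eqmxMfull; rewrite row_full_unit col_ebase_unit.
apply: eqmx_trans pidB; rewrite mulmxA; apply: eqmxMr.
have -> : (pid_mx t : 'M_(t + k)) *m h = h *m pid_mx t.
  by rewrite pid_mx_block !mulmx_block !mul0mx !mulmx0 !mul1mx !mulmx1 !addr0 ?mul0mx ?add0r.
by apply: eqmxMfull; rewrite row_full_unit.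
Qed.

(** * Products of two-step flag varieties

    The product over [v : I] of the varieties of flags U_1 <= U_2 in
    V_v = K^(n v) with dim U_1 = a v and dim U_2 = b v; Gr(b v, V_v) is the
    case a v = 0.  A subspace is the row space of a square matrix, normalised
    by [<<_>>%MS] so that equal subspaces are equal matrices. *)

Section Flags.
Variables (K : fieldType) (I : finType) (n a b : I -> nat).

Definition flags : Type := forall v : I, 'M[K]_(n v) * 'M[K]_(n v).

Definition is_flag (x : flags) : Prop :=
  forall v, [/\ <<(x v).1>>%MS = (x v).1, <<(x v).2>>%MS = (x v).2,
                \rank (x v).1 = a v, \rank (x v).2 = b v
              & ((x v).1 <= (x v).2)%MS].

(** A chart is given by a basis of every V_v (the rows of an invertible matrix
    g); it is the translate by g of the big cell, consisting of the flags
    spanned by the first [a v] and the first [b v] rows of u g, where u is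
    block upper unitriangular for the block sizes a v, b v - a v, n v - b v.
    The coordinates are the entries of the strictly upper blocks of u. *)
Definition block_index (v : I) (k : 'I_(n v)) : nat := ((a v <= k) + (b v <= k))%N.

Definition position : finType := {v : I & ('I_(n v) * 'I_(n v))%type}.

Definition is_coord (e : position) : bool :=
  (block_index (tagged e).1 < block_index (tagged e).2)%N.

Definition coord : finType := {e : position | is_coord e}.

Definition unip (z : 'rV[K]_#|{: coord}|) (v : I) : 'M[K]_(n v) :=
  \matrix_(k, l)
    if (insub (Tagged (fun w => ('I_(n w) * 'I_(n w))%type) (k, l))
          : option coord) is Some e
    then z 0 (enum_rank e) else (k == l)%:R.

Definition flag_cell : Type := forall v : I, {g : 'M[K]_(n v) | g \in unitmx}.

Definition adapted_basis (c : flag_cell) (z : 'rV[K]_#|{: coord}|) (v : I) :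
  'M[K]_(n v) := unip z v *m val (c v).

Definition flag_param (c : flag_cell) (z : 'rV[K]_#|{: coord}|) : flags :=
  fun v => (<<(pid_mx (a v) : 'M[K]_(n v)) *m adapted_basis c z v>>%MS,
            <<(pid_mx (b v) : 'M[K]_(n v)) *m adapted_basis c z v>>%MS).

Implicit Types c : flag_cell.

Lemma unipE z v k l : unip z v k l =
  if (insub (Tagged (fun w => ('I_(n w) * 'I_(n w))%type) (k, l))
          : option (coord)) is Some e
    then z 0 (enum_rank e) else (k == l)%:R.
Proof. by rewrite mxE. Qed.

Lemma unip0 z v (k l : 'I_(n v)) : ~~ (block_index k < block_index l)%N ->
  unip z v k l = (k == l)%:R.
Proof. by move=> kl; rewrite unipE insubN. Qed.

Lemma block_index_lt v (k l : 'I_(n v)) :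
  (block_index k < block_index l)%N -> (k < l)%N.
Proof.
rewrite ltnNge [(k < l)%N]ltnNge; apply: contra => lk.
by rewrite /block_index leq_add //; [case: (a v <= l)%N / idP|case: (b v <= l)%N / idP] => // h;
  rewrite (leq_trans h lk).
Qed.

Lemma unip_unit z v : unip z v \in unitmx.
Proof.
rewrite unitmxE -det_tr det_trig; last first.
  apply/is_trig_mxP => k l kl; rewrite mxE unip0; last first.
    by apply/negP => /block_index_lt; rewrite ltnNge ltnW.
  by case: eqP kl => // ->; rewrite ltnn.
by rewrite big1 ?unitr1 // => k _; rewrite mxE unip0 ?ltnn ?eqxx.
Qed.

Lemma unip_const0 v : unip 0 v = 1%:M.
Proof.
apply/matrixP=> k l; rewrite unipE !mxE; case: insubP => // e + he; rewrite mxE.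
by move/block_index_lt=> /=; case: (k =P l) => // ->; rewrite ltnn.
Qed.

Lemma adapted_basis_unit c (z : 'rV_#|{: coord}|) v :
  adapted_basis c z v \in unitmx.
Proof. by rewrite unitmx_mul unip_unit; exact: valP. Qed.

(** The charts cover exactly the flag variety, when a v <= b v <= n v. *)
Lemma flag_paramP (x : flags) :
  (forall v, (a v <= b v <= n v)%N) ->
  is_flag x <-> exists c z, x = flag_param c z.
Proof.
move=> abn; split; last first.
  move=> [c [z ->]] v; have /andP[ab bn] := abn v.
  have freeA : row_free (adapted_basis c z v).
    by rewrite row_free_unit adapted_basis_unit.
  rewrite /flag_param /=; split.
  - by rewrite genmx_id.
  - by rewrite genmx_id.
  - by rewrite mxrank_gen mxrankMfree // rank_pid_mx // (leq_trans ab).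
  - by rewrite mxrank_gen mxrankMfree // rank_pid_mx.
  - rewrite !genmxE (_ : (pid_mx (a v) : 'M_(n v)) = pid_mx (a v) *m (pid_mx (b v) : 'M_(n v))).
      by rewrite -mulmxA submxMl.
    by rewrite mul_pid_mx (minn_idPl ab) (minn_idPr (leq_trans ab bn)).
move=> fx.
have H : forall v, exists g : {g : 'M[K]_(n v) | g \in unitmx},
  ((pid_mx (a v) : 'M_(n v)) *m val g :=: (x v).1)%MS /\
  ((pid_mx (b v) : 'M_(n v)) *m val g :=: (x v).2)%MS.
  move=> v; have [_ _ ra rb le12] := fx v.
  by have [g gu ?] := basis_exists ra rb le12; exists (exist _ g gu).
pose g v := projT1 (cid (H v)).
have hg v := projT2 (cid (H v)).
exists g, 0; apply: functional_extensionality_dep => v.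
have [g1 g2 _ _ _] := fx v; have [h1 h2] := hg v.
rewrite /flag_param /adapted_basis unip_const0 mul1mx [LHS]surjective_pairing -g1 -g2.
by congr (_, _); apply: eq_genmx; apply: eqmx_sym.
Qed.

Lemma flag_param_inj c : injective (flag_param c).
Proof.
move=> z z' E.
have {}E v (t : nat) : t = a v \/ t = b v ->
   exists X : 'M_(n v), (pid_mx t : 'M_(n v)) *m unip z v = X *m (pid_mx t : 'M_(n v)) *m unip z' v.
  move=> ht; have /submxP[X XE]: ((pid_mx t : 'M_(n v)) *m unip z v <= (pid_mx t : 'M_(n v)) *m unip z' v)%MS.
    have := congr1 (fun x : flags => x v) E; rewrite /flag_param /adapted_basis.
    have vu : val (c v) \in unitmx by exact: valP.
    case=> /genmxP/eqmxP h1 /genmxP/eqmxP h2.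
    have [ht' | ht'] := ht; [move: h1 | move: h2]; rewrite -ht' !mulmxA => hh.
      by rewrite -(submxMfree _ _ (_ : row_free (val (c v)))) ?row_free_unit ?hh.
    by rewrite -(submxMfree _ _ (_ : row_free (val (c v)))) ?row_free_unit ?hh.
  by exists X; rewrite XE mulmxA.
apply/rowP => j; rewrite -(enum_valK j); move: (enum_val j) => e {j}.
case: e => -[v [k l]] he; have := he; rewrite /is_coord /= => kl.
have uE y : unip y v k l = y 0 (enum_rank (exist _ (Tagged _ (k, l)) he)).
  rewrite unipE; case: insubP => [e' _ e'E|]; last by rewrite he.
  by congr (y 0 (enum_rank _)); apply: val_inj.
rewrite -!uE.
have [t tab [kt tl hs]] : exists2 t, t = a v \/ t = b v &
   [/\ (k < t)%N, (t <= l)%N & forall s : 'I_(n v), (s < t)%N -> ~~ (block_index k < block_index s)%N].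
  move: kl; rewrite /block_index.
  have [ak|ka] := leqP (a v) k; have [bk|kb] := leqP (b v) k => //=.
  - by case: (a v <= l)%N; case: (b v <= l)%N.
  - move=> h; exists (b v); [by right|split=> // [|s sb]].
      by move: h; case: (a v <= l)%N; case: (b v <= l)%N.
    by rewrite (leqNgt (b v)) sb; case: (a v <= s)%N.
  - move=> h; exists (a v); [by left|split=> // [|s sb]].
      by move: h; case: (a v <= l)%N; case: (b v <= l)%N.
    by rewrite (leqNgt (a v)) sb; case: (b v <= s)%N.
  have [ab|ba] := leqP (a v) (b v) => h.
    exists (a v); [by left|split=> // [|s sb]].
      move: h; case: (leqP (a v) l) => //= la; rewrite (leqNgt (b v)).
      by rewrite (leq_trans la ab).
    by rewrite (leqNgt (a v)) sb (leqNgt (b v)) (leq_trans sb ab).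
  exists (b v); [by right|split=> // [|s sb]].
    move: h; case: (leqP (b v) l) => //= lb; rewrite (leqNgt (a v)).
    by rewrite (leq_trans lb (ltnW ba)).
  by rewrite (leqNgt (b v)) sb (leqNgt (a v)) (leq_trans sb (ltnW ba)).
have [X XE] := E v t tab.
pose y := row k (X *m (pid_mx t : 'M_(n v))).
have yE s : unip z v k s = \sum_w y 0 w * unip z' v w s.
  move: XE; move: (unip z v) (unip z' v) => U U'.
  move/(congr1 (fun A : 'M_(n v) => A k s)); rewrite /= !mxE => h.
  transitivity (\sum_w (pid_mx t : 'M[K]_(n v)) k w * U w s).
    rewrite (bigD1 k) //= big1 ?addr0 => [|w wk]; first by rewrite mxE eqxx kt mul1r.
    have /negPf wk' : k != w :> nat by rewrite eq_sym.
    by rewrite mxE wk' mul0r.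
  by rewrite h; apply: eq_bigr => w _; rewrite /y !mxE.
have y0 (s : 'I_(n v)) : (t <= s)%N -> y 0 s = 0.
  move=> ts; rewrite /y !mxE big1 // => w _; rewrite mxE.
  by case: eqP => [->|]; rewrite ?mulr0 // ltnNge ts mulr0.
have yk (N : nat) (s : 'I_(n v)) : (s < N)%N -> y 0 s = (k == s)%:R.
  elim: N s => // N IH s sN.
  have [st|ts] := ltnP s t; last first.
    by rewrite y0 //; case: (k =P s) => // ks; move: kt; rewrite ks ltnNge ts.
  rewrite -(unip0 z (hs s st)) yE (bigD1 s) //= [unip z' v s s]unip0 ?ltnn // eqxx mulr1.
  rewrite big1 ?addr0 // => w ws.
  have [wls|sw] := ltnP w s; last first.
    rewrite unip0 ?(negPf ws) ?mulr0 //.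
    by apply/negP => /block_index_lt; rewrite ltnNge sw.
  rewrite IH ?(leq_trans wls) //; case: (k =P w) => [kw|]; last by rewrite mul0r.
  by rewrite -kw unip0 ?hs // kw (negPf ws) mulr0.
rewrite yE (bigD1 k) //= (yk _ _ (ltn_ord k)) eqxx mul1r big1 ?addr0 // => w wk.
by rewrite (yk _ _ (ltn_ord w)) eq_sym (negPf wk) mul0r.
Qed.
Definition flag_variety : atlas K := Atlas flag_param.

(** The tautological subbundle whose fibre is spanned by the first [k] vectors
    of the adapted bases (k = a v or k = b v), with these as frame, and the
    quotient of the trivial bundle V_v by it, with the images of the other
    vectors of the adapted bases as frame.  The change of adapted bases is
    block lower triangular over an overlap. *)
Definition change_basis (v : I) (c c' : flag_cell) z z' : 'M[K]_(n v) :=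
  adapted_basis c z v *m invmx (adapted_basis c' z' v).

Definition sub_block (v : I) (S : {set 'I_(n v)}) (A : 'M[K]_(n v)) :
  'M[K]_#|S| := mxsub enum_val enum_val A.

Definition taut_bundle (v : I) (k : nat) : vbundle flag_variety :=
  @VBundle K flag_variety #|[set s : 'I_(n v) | (s < k)%N]|
    (fun c c' z z' => sub_block _ (change_basis v c c' z z')).

Definition quot_bundle (v : I) (k : nat) : vbundle flag_variety :=
  @VBundle K flag_variety #|[set s : 'I_(n v) | (k <= s)%N]|
    (fun c c' z z' => sub_block _ (change_basis v c c' z z')).

End Flags.

Arguments flag_variety K {I} n a b.
Arguments taut_bundle K {I} n a b v k.
Arguments quot_bundle K {I} n a b v k.

(** * The source-sink quiver of type A_(2m)

    The vectors d, r, p, q are indexed from 1, and their values outside the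
    ranges 1..2m, 1..2m-1, 1..m-1, 1..m-1 are irrelevant.  V_j = K^(d j) is the
    space of row vectors, and a linear map is a matrix acting on the right. *)

Section Quiver.
Variables (K : fieldType) (m : nat) (d r p q : nat -> nat).

(** [odd_arrow i] is the map V_(2i-1) -> V_(2i) on the arrow a_(2i-1), for
    1 <= i <= m, and [even_arrow i] the map V_(2i+1) -> V_(2i) on the arrow
    a_(2i), for 1 <= i <= m-1. *)
Record quiver_rep := QuiverRep {
  odd_arrow : forall i : nat, 'M[K]_(d i.*2.-1, d i.*2);
  even_arrow : forall i : nat, 'M[K]_(d i.*2.+1, d i.*2)
}.

Definition has_ranks (phi : quiver_rep) : Prop :=
  [/\ forall i, (1 <= i <= m)%N -> \rank (odd_arrow phi i) = r i.*2.-1,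
      forall i, (1 <= i < m)%N -> \rank (even_arrow phi i) = r i.*2,
      forall i, (1 <= i < m)%N ->
        \rank (odd_arrow phi i + even_arrow phi i)%MS = p i
    & forall i, (1 <= i < m)%N ->
        \rank (kermx (odd_arrow phi i.+1) :&: kermx (even_arrow phi i))%MS
          = q i].

(** The vertices 1..2m-1 contributing to F (for 1 <= m), numbered from 0. *)
Definition vertex : finType := 'I_(m.-1.*2.+1).

Definition vtx (j : nat) : vertex := inord j.-1.

(** The dimensions of U_(j,1) and U_(j,2); the Grassmannian at the vertex 1 is
    written as a flag variety with U_(1,1) = 0. *)
Definition step1 (j : nat) : nat :=
  (if j == 1 then 0 else if odd j then q j./2 else r j)%N.

Definition step2 (j : nat) : nat :=
  (if odd j then d j - r j else p j./2)%N.

Definition dim (v : vertex) : nat := d v.+1.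
Definition dim1 (v : vertex) : nat := step1 v.+1.
Definition dim2 (v : vertex) : nat := step2 v.+1.

Definition F : atlas K := flag_variety K dim dim1 dim2.

Definition U1 (j : nat) : vbundle F :=
  taut_bundle K dim dim1 dim2 (vtx j) (step1 j).
Definition U2 (j : nat) : vbundle F :=
  taut_bundle K dim dim1 dim2 (vtx j) (step2 j).
Definition VmodU1 (j : nat) : vbundle F :=
  quot_bundle K dim dim1 dim2 (vtx j) (step1 j).
Definition VmodU2 (j : nat) : vbundle F :=
  quot_bundle K dim dim1 dim2 (vtx j) (step2 j).

Definition Hom_bundle (E E' : vbundle F) : vbundle F :=
  tensor_bundle (dual_bundle E) E'.

Definition W : vbundle F :=
  sum_bundle (Hom_bundle (VmodU2 m.*2.-1) (trivial_bundle (d m.*2)))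
    (\big[@sum_bundle K F/trivial_bundle 0]_(1 <= i < m)
       sum_bundle (Hom_bundle (VmodU2 i.*2.-1) (U2 i.*2))
                  (Hom_bundle (VmodU1 i.*2.+1) (U1 i.*2))).

Definition crepant : Prop :=
  lbundle_iso (det_bundle W) (canonical_bundle F).

(** None of the tautological subbundles U_(i,k) of V_i on F is 0 or V_i
    (apart from the conventional U_(1,1) = 0). *)
Definition proper_flags : Prop :=
  [/\ (0 < step2 1 < d 1)%N,
      forall i, (1 <= i < m)%N -> (0 < step1 i.*2)%N /\ (step2 i.*2 < d i.*2)%N
    & forall i, (1 <= i < m)%N ->
        (0 < step1 i.*2.+1)%N /\ (step2 i.*2.+1 < d i.*2.+1)%N].

End Quiver.

Arguments has_ranks {K} m {d} r p q phi.

(* Main.v *)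
Require Import Defs.
From mathcomp Require Import boolp classical_sets reals.
From mathcomp Require Import all_boot all_order all_algebra all_fingroup.
From mathcomp Require Import complex.
From mathcomp Require Import mxtens mpoly zify ring.

(** The frame of every bundle changes over an overlap by a product of three
    basic functions attached to the vertices v: the determinants x_v and y_v of
    the changes of frames of U_(v,1) and U_(v,2), and the determinant g_v of the
    change of basis of V_v, which is constant.  Hence det W is a product of
    powers of the x_v, y_v and g_v, and so is K_F, whose exponents at v are
    dim U_(v,2), dim V_v - dim U_(v,1) and - dim U_(v,2).

    For K_F, differentiate U h = G U', where U and U' are the unipotent
    matrices of coordinates in two charts, h is constant and G is block lower
    triangular: dU' U'^-1 is the strictly upper block part of
    G^-1 dU U^-1 G, so that the jacobian determinant is that of the action of
    G by conjugation on the matrices modulo the block lower triangular ones.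

    If the exponents of the x_v and y_v in det W and K_F agree, then the two
    bundles differ by constants.  Conversely, an isomorphism is given by
    polynomials without zeros, hence by constants; comparing the charts of two
    bases which differ by the transposition of the last vector of U_(v,1) (or
    U_(v,2)) with the next vector yields an equation t^e = t^e' for all
    t != 0, where e and e' are the two exponents of x_v (or y_v). The equality
    of all exponents is the list of conditions of the theorem. *)

Set Implicit Arguments.
Unset Strict Implicit.
Unset Printing Implicit Defensive.

Import GRing.Theory Num.Theory.
Local Open Scope ring_scope.

(** * Determinants *)

Section Determinants.
Variable K : fieldType.

Lemma det_mxsub_perm n (s : 'S_n) (A : 'M[K]_n) : \det (mxsub s s A) = \det A.
Proof.
have -> : mxsub s s A = perm_mx s *m A *m (perm_mx s)^T.
  rewrite tr_perm_mx -row_permE -[in perm_mx _](invgK s^-1)%g invgK.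
  by rewrite -col_permE; apply/matrixP=> i j; rewrite !mxE.
by rewrite !det_mulmx det_tr det_perm mulrAC -signr_addb addbb mul1r.
Qed.

(** Two injective enumerations of the same set of indices differ by a permutation, so a principal
    minor depends only on the set. *)
Lemma det_mxsub_codom p p' n (f : 'I_p -> 'I_n) (g : 'I_p' -> 'I_n)
    (A : 'M[K]_n) :
  injective f -> injective g -> codom f =i codom g ->
  \det (mxsub f f A) = \det (mxsub g g A).
Proof.
move=> f_inj g_inj fg.
have fgP i : f i \in codom g by rewrite -fg codom_f.
pose h i := iinv (fgP i).
have hE i : g (h i) = f i by rewrite f_iinv.
have h_inj : injective h by move=> i j /(congr1 g); rewrite !hE => /f_inj.
have pp' : p = p'.
  by have := eq_card fg; rewrite !card_codom // !card_ord.
subst p'.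
have -> : mxsub f f A = mxsub (perm h_inj) (perm h_inj) (mxsub g g A).
  by apply/matrixP=> i j; rewrite !mxE !permE !hE.
exact: det_mxsub_perm.
Qed.

Lemma codom_enum_val (T : finType) (S : {set T}) :
  codom (@enum_val T (mem S)) =i S.
Proof.
move=> x; apply/codomP/idP => [[i ->]|xS]; first exact: enum_valP.
by exists (enum_rank_in xS x); rewrite enum_rankK_in.
Qed.

(** The counterpart of [sub_block] for a single size instead of a family of sizes; the two are
    convertible. *)
Definition principal n (S : {set 'I_n}) (A : 'M[K]_n) : 'M[K]_#|S| :=
  mxsub enum_val enum_val A.

Lemma det_mxsub_image p n (f : 'I_p -> 'I_n) (S : {set 'I_n}) (A : 'M[K]_n) :
  injective f -> codom f =i S -> \det (mxsub f f A) = \det (principal S A).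
Proof.
move=> f_inj fS; apply: det_mxsub_codom => // [|x]; first exact: enum_val_inj.
by rewrite fS codom_enum_val.
Qed.

Lemma det_split n (S : {set 'I_n}) (A : 'M[K]_n) :
  (forall x y, x \in S -> y \notin S -> A x y = 0) ->
  \det A = \det (principal S A) * \det (principal (~: S) A).
Proof.
move=> A0.
(* Listing the indices of [S] first and the others afterwards makes the matrix block lower
   triangular. *)
pose f (i : 'I_(#|S| + #|~: S|)) : 'I_n :=
  match split i with inl j => enum_val j | inr j => enum_val j end.
have f_inj : injective f.
  move=> i j; rewrite /f; case: splitP => i' ii'; case: splitP => j' jj' E.
  - by apply: val_inj; rewrite /= ii' jj' (enum_val_inj E).
  - by have := enum_valP j'; rewrite -E inE enum_valP.
  - by have := enum_valP i'; rewrite E inE enum_valP.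
  - by apply: val_inj; rewrite /= ii' jj' (enum_val_inj E).
have fT : codom f =i codom (@id 'I_n).
  move=> x; rewrite [RHS](_ : _ = true); last by apply/codomP; exists x.
  apply/codomP; have [xS|xS] := boolP (x \in S).
    exists (lshift _ (enum_rank_in xS x)); rewrite /f.
    case: splitP => j /= E; first by rewrite -(val_inj E) enum_rankK_in.
    by have := ltn_ord (enum_rank_in xS x); rewrite E ltnNge leq_addr.
  rewrite -in_setC in xS; exists (rshift _ (enum_rank_in xS x)); rewrite /f.
  case: splitP => j /= E; first by have := ltn_ord j;
    rewrite -E ltnNge leq_addr.
  by move/addnI/val_inj: E => <-; rewrite enum_rankK_in.
have -> : \det A = \det (mxsub f f A).
  rewrite (det_mxsub_codom _ f_inj (@inj_id _) fT).
  by congr (\det _); apply/matrixP=> i j; rewrite mxE.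
rewrite -[mxsub f f A]submxK.
have -> : ursubmx (mxsub f f A) = 0.
  apply/matrixP=> i j; rewrite !mxE /f; case: splitP => i' /= Ei; last first.
    by have := ltn_ord i; rewrite Ei ltnNge leq_addr.
  case: splitP => j' /= Ej; first by have := ltn_ord j';
    rewrite -Ej ltnNge leq_addr.
  by rewrite A0 ?enum_valP // -in_setC enum_valP.
rewrite det_lblock; congr (_ * _); congr (\det _); apply/matrixP=> i j;
  rewrite !mxE /f.
  case: splitP => i' /= Ei; last by have := ltn_ord i;
    rewrite Ei ltnNge leq_addr.
  case: splitP => j' /= Ej; last by have := ltn_ord j;
    rewrite Ej ltnNge leq_addr.
  by rewrite (val_inj Ei) (val_inj Ej).
case: splitP => i' /= Ei; first by have := ltn_ord i';
  rewrite -Ei ltnNge leq_addr.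
case: splitP => j' /= Ej; first by have := ltn_ord j';
  rewrite -Ej ltnNge leq_addr.
by rewrite (val_inj (addnI Ei)) (val_inj (addnI Ej)).
Qed.

Lemma eq_det_principal n (S : {set 'I_n}) (A B : 'M[K]_n) :
  {in S &, forall x y, A x y = B x y} ->
  \det (principal S A) = \det (principal S B).
Proof.
by move=> AB; congr (\det _); apply/matrixP=> i j; rewrite !mxE AB ?enum_valP.
Qed.

Lemma det_principal1 n (S : {set 'I_n}) : \det (principal S 1%:M) = 1 :> K.
Proof.
rewrite -[RHS](det1 K #|S|); congr (\det _); apply/matrixP=> i j.
by rewrite !mxE (inj_eq enum_val_inj).
Qed.

Lemma det_fibers n (T : finType) (f : 'I_n -> T) (A : 'M[K]_n) :
  (forall x y, f x != f y -> A x y = 0) ->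
  \det A = \prod_(t : T) \det (principal [set x | f x == t] A).
Proof.
move=> A0.
(* [B r] keeps the blocks over the values in [r] and replaces the others by identity blocks, so that
   one fibre is split off at each step of the induction. *)
pose B (r : seq T) : 'M[K]_n :=
  \matrix_(x, y) if f x \in r then A x y else (x == y)%:R.
have -> : \det A = \det (B (index_enum T)).
  by congr (\det _); apply/matrixP=> x y; rewrite mxE mem_index_enum.
elim: (index_enum T) (index_enum_uniq T) => [_|t r IH /= /andP[tr /IH {}IH]].
  rewrite big_nil; have -> : B [::] = 1%:M by apply/matrixP=> x y; rewrite !mxE.
  exact: det1.
rewrite big_cons -{}IH.
have B0 r' x y : f x != f y -> B r' x y = 0.
  move=> fxy; rewrite mxE A0 //; case: ifP => // _.
  by case: (x =P y) fxy => // ->; rewrite eqxx.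
pose S := [set x | f x == t].
have SB r' x y : x \in S -> y \notin S -> B r' x y = 0.
  by rewrite !inE => /eqP <-; rewrite eq_sym; exact: B0.
rewrite (det_split (SB (t :: r))) (det_split (SB r)).
rewrite (@eq_det_principal _ S (B (t :: r)) A); last first.
  by move=> x y; rewrite inE => xS _; rewrite mxE inE xS.
rewrite (@eq_det_principal _ S (B r) 1%:M) ?det_principal1 ?mul1r; last first.
  by move=> x y; rewrite inE => /eqP xS _; rewrite !mxE xS (negPf tr).
congr (_ * _); apply: eq_det_principal => x y.
by rewrite !inE => /negPf xS _; rewrite !mxE inE xS.
Qed.

(** Each factor of A (x) B = (A (x) 1) (1 (x) B) is block diagonal along the fibres of one component
    of the index, and all its blocks are copies of A or of B. *)
Lemma det_tens p q (A : 'M[K]_p) (B : 'M[K]_q) :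
  \det (A *t B) = \det A ^+ q * \det B ^+ p.
Proof.
have -> : A *t B = (A *t 1%:M) *m (1%:M *t B).
  by rewrite tensmx_mul mulmx1 mul1mx.
rewrite det_mulmx; congr (_ * _).
  pose f (x : 'I_(p * q)) := (mxtens_unindex x).2.
  rewrite (@det_fibers _ _ f) => [|x y fxy]; last first.
    by rewrite !mxE (negPf fxy) mulr0.
  rewrite -[in RHS](card_ord q) -prodr_const; apply: eq_bigr => t _.
  have inj : injective (fun i : 'I_p => mxtens_index (i, t)).
    by move=> i j /(can_inj (@mxtens_indexK _ _)) [].
  rewrite -(det_mxsub_image _ inj).
    congr (\det _); apply/matrixP=> i j.
    by rewrite mxE tensmxE mxE eqxx mulr1.
  move=> x; rewrite inE; apply/codomP/eqP => [[i ->]|<-].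
    by rewrite /f mxtens_indexK.
  exists (mxtens_unindex x).1.
  by rewrite /f -surjective_pairing mxtens_unindexK.
pose f (x : 'I_(p * q)) := (mxtens_unindex x).1.
rewrite (@det_fibers _ _ f) => [|x y fxy]; last first.
  by rewrite !mxE (negPf fxy) mul0r.
rewrite -[in RHS](card_ord p) -prodr_const; apply: eq_bigr => t _.
have inj : injective (fun i : 'I_q => mxtens_index (t, i)).
  by move=> i j /(can_inj (@mxtens_indexK _ _)) [].
rewrite -(det_mxsub_image _ inj).
  congr (\det _); apply/matrixP=> i j.
  by rewrite mxE tensmxE mxE eqxx mul1r.
move=> x; rewrite inE; apply/codomP/eqP => [[i ->]|<-].
  by rewrite /f mxtens_indexK.
exists (mxtens_unindex x).2.
by rewrite /f -surjective_pairing mxtens_unindexK.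
Qed.

End Determinants.

(** * Partial derivatives of rational functions *)

Section Univariate.

(** The natural numbers are distinct in characteristic zero and provide more roots than the degree
    allows. *)
Lemma poly_eq0_horner (K : numDomainType) (p : {poly K}) :
  (forall t, p.[t] = 0) -> p = 0.
Proof.
move=> p0; apply/eqP; apply: contraT => pN0.
pose rs : seq K := [seq k%:R | k <- iota 0 (size p)].
have := @max_poly_roots _ p rs pN0; rewrite size_map size_iota ltnn; apply.
  by apply/allP => x _; apply/rootP.
by rewrite map_inj_uniq ?iota_uniq // => i j /eqP; rewrite eqr_nat => /eqP.
Qed.

Lemma poly_nonvanishing_const (K : closedFieldType) (p : {poly K}) :
  (forall t, p.[t] != 0) -> exists2 c, c != 0 & forall t, p.[t] = c.
Proof.
move=> pN0; have [/closed_rootP[x]|] := boolP (size p != 1).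
  by rewrite rootE (negPf (pN0 x)).
rewrite negbK => /size_poly1P[c c0 ->]; exists c => // t; exact: hornerC.
Qed.

End Univariate.

Section Lines.
Variables (K : fieldType) (n : nat) (z w : 'rV[K]_n).

(** The restriction to the line z + t w; it reduces partial derivatives and constancy to polynomials
    in one variable. *)
Definition line_poly (P : {mpoly K[n]}) : {poly K} :=
  mmap polyC (fun i => (z 0 i)%:P + w 0 i *: 'X) P.

Lemma horner_line_poly P t :
  (line_poly P).[t] = P.@[fun i => (z + t *: w) 0 i].
Proof.
elim/mpolyind: P => [|c m P _ _ IH].
  by rewrite /line_poly mmap0 horner0 meval0.
rewrite mevalD -IH /line_poly mmapD hornerD mmapZ mevalZ hornerM hornerC.
congr (_ * _ + _); rewrite mmapX mevalX /mmap1 horner_prod.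
apply: eq_bigr => i _; rewrite horner_exp !mxE !hornerE.
by congr (_ ^+ _); rewrite mulrC.
Qed.

End Lines.

(** Restriction to the line is a ring morphism and both sides obey the Leibniz rule, so constants
    and variables are enough. *)
Lemma deriv_line_poly (K : fieldType) n (z : 'rV[K]_n) (l : 'I_n) P :
  (line_poly z (delta_mx 0 l) P)^`() = line_poly z (delta_mx 0 l) P^`M(l).
Proof.
set L := line_poly _ _.
pose good P := (L P)^`() = L P^`M(l).
have goodD P1 P2 : good P1 -> good P2 -> good (P1 + P2).
  by rewrite /good /L /line_poly mderivD !mmapD derivD => -> ->.
have goodM P1 P2 : good P1 -> good P2 -> good (P1 * P2).
  by rewrite /good /L mderivM /line_poly mmapD !rmorphM derivM => -> ->.
have goodC c : good c%:MP.
  by rewrite /good /L /line_poly mderivC mmapC mmap0 derivC.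
have goodX i : good 'X_i.
  rewrite /good /L /line_poly mderivX mnm1E mmapZ !mmapX mmap1U.
  rewrite derivD derivC add0r derivZ derivX mxE eqxx /=.
  case: (i =P l) => [->|_]; last by rewrite scale0r mul0r.
  suff -> : (U_(l) - U_(l))%MM = 0%MM by rewrite mmap11 scale1r mulr1.
  by apply/mnmP => j; rewrite mnmBE mnm0E subnn.
rewrite -/(good P).
move: P; apply: mpolyind => [|c m P _ _ IH]; first by rewrite -mpolyC0;
  exact: (goodC).
apply: goodD IH; rewrite -mul_mpolyC; apply: (goodM); first exact: (goodC).
rewrite mpolyXE_id; apply: (big_ind good) => //; first by rewrite -mpolyC1;
  exact: (goodC).
move=> i _; elim: (m i) => [|k IHk].
  by rewrite expr0 -mpolyC1; exact: goodC.
by rewrite exprS; apply: goodM IHk.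
Qed.

Section Partials.
Variables (K : numFieldType) (X : atlas K).
Local Notation N := (coords X).
Implicit Types (f g : 'rV[K]_N -> K) (z : 'rV[K]_N) (l : 'I_N).

Lemma poly_valueM (P Q : {mpoly K[N]}) z :
  poly_value (X := X) (P * Q) z = poly_value (X := X) P z * poly_value (X := X)
    Q z.
Proof. exact: mevalM. Qed.

Lemma poly_valueD (P Q : {mpoly K[N]}) z :
  poly_value (X := X) (P + Q) z = poly_value (X := X) P z + poly_value (X := X)
    Q z.
Proof. exact: mevalD. Qed.

(** If P / Q and P' / Q' both represent [f], then P Q' = P' Q on the line through [z] in the
    direction [l]; this identity and its derivative at 0 give the equality of the two quotient
    rules. *)
Lemma is_partial_uniq f z l v v' :
  is_partial (X := X) f z l v -> is_partial (X := X) f z l v' -> v = v'.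
Proof.
move=> [P [Q [Q0 fE ->]]] [P' [Q' [Q'0 fE' ->]]].
set L := line_poly z (delta_mx 0 l).
have L0 S : (L S).[0] = poly_value (X := X) S z.
  by rewrite /L horner_line_poly scale0r addr0.
have LE : L P * L Q' = L P' * L Q.
  (* The fractions represent [f] only off the zeros of their denominators, hence the extra factors,
     which are cancelled afterwards. *)
  have : L Q * L Q' * (L P * L Q' - L P' * L Q) = 0.
    apply: poly_eq0_horner => t.
    have [Qt|Qt] := eqVneq (L Q).[t] 0; first by rewrite !hornerM Qt !mul0r.
    have [Qt'|Qt'] := eqVneq (L Q').[t] 0.
      by rewrite !hornerM Qt' mulr0 mul0r.
    have := fE (z + t *: delta_mx 0 l); rewrite /poly_value -!horner_line_poly.
    move/(_ Qt) => E.
    have := fE' (z + t *: delta_mx 0 l); rewrite /poly_value -!horner_line_poly.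
    move/(_ Qt'); rewrite {}E => /eqP; rewrite eqr_div // => /eqP E.
    by rewrite hornerM hornerD hornerN !hornerM E subrr mulr0.
  have LN0 S : poly_value (X := X) S z != 0 -> L S != 0.
    by rewrite -L0; apply: contraNneq => ->; rewrite horner0.
  move/eqP; rewrite mulf_eq0 mulf_eq0 (negPf (LN0 _ Q0)) (negPf (LN0 _ Q'0)) /=.
  by rewrite subr_eq0 => /eqP.
have dL S : (L S)^`() = L S^`M(l) by exact: deriv_line_poly.
have e0 := congr1 (fun p => p.[0]) LE.
have e1 := congr1 (fun p => (p^`()).[0]) LE.
rewrite !derivM !dL !hornerD !hornerM !L0 in e1.
rewrite !hornerM !L0 in e0.
move: e0 e1 Q0 Q'0.
move: (poly_value P z) (poly_value Q z) (poly_value P' z) (poly_value Q' z).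
move: (poly_value P^`M(l) z) (poly_value Q^`M(l) z).
move: (poly_value P'^`M(l) z) (poly_value Q'^`M(l) z) => dp' dq' dp dq p q p'
  q' e0 e1 q0 q'0.
have -> : p = p' * q / q' by rewrite -e0 mulfK.
have -> : dp = (dp' * q + p' * dq - p * dq') / q'.
  by rewrite -e1 addrK mulfK.
have -> : p = p' * q / q' by rewrite -e0 mulfK.
by field; rewrite q0 q'0.
Qed.

Lemma partialE f z l v : is_partial (X := X) f z l v -> partial (X := X) f z l
  = v.
Proof.
move=> fv; apply: is_partial_uniq (fv).
exact: (xgetPex 0 (ex_intro _ v fv)).
Qed.

(** Multiplying numerator and denominator by the numerator and denominator of [g] shrinks the
    neighbourhood to one where [g] does not vanish, hence where [f] and [f'] agree. *)
Lemma is_partial_near g w f f' z l v :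
  is_partial (X := X) g z l w -> g z != 0 ->
  (forall y, g y != 0 -> f y = f' y) ->
  is_partial (X := X) f z l v -> is_partial (X := X) f' z l v.
Proof.
move=> [P' [Q' [Q'0 gE _]]] gz ff' [P [Q [Q0 fE ->]]].
have P'0 : poly_value (X := X) P' z != 0.
  by move: gz; rewrite gE // mulf_eq0 invr_eq0 (negPf Q'0) orbF.
exists (P * (P' * Q')), (Q * (P' * Q')); split.
- by rewrite !poly_valueM !mulf_neq0.
- move=> y; rewrite !poly_valueM !mulf_eq0 !negb_or => /and3P[Qy P'y Q'y].
  rewrite -ff' ?fE // ?gE // ?mulf_neq0 ?invr_eq0 //.
  by field; rewrite ?Qy ?P'y ?Q'y.
- by rewrite !mderivM !(poly_valueM, poly_valueD); field; rewrite ?Q0 ?P'0 ?Q'0.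
Qed.

Lemma is_partial_cst c z l : is_partial (X := X) (fun=> c) z l 0.
Proof.
exists c%:MP, 1; split=> [|y _|].
- by rewrite /poly_value meval1 oner_eq0.
- by rewrite /poly_value meval1 mevalC divr1.
- by rewrite -mpolyC1 !mderivC /poly_value !mevalC !(mul0r, mulr0, subr0).
Qed.

Lemma is_partial_coord k z l :
  is_partial (X := X) (fun y => y 0 k) z l (k == l)%:R.
Proof.
exists 'X_k, 1; split=> [|y _|].
- by rewrite /poly_value meval1 oner_eq0.
- by rewrite /poly_value meval1 mevalXU divr1.
- rewrite mderivX mnm1E -mpolyC1 mderivC /poly_value !mevalC mulr0 subr0.
  rewrite mulr1 expr1n divr1; case: (k =P l) => [->|_];
    last by rewrite scale0r meval0.
  rewrite scale1r; suff -> : (U_(l) - U_(l))%MM = 0%MM by rewrite mpolyX0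
    meval1.
  by apply/mnmP => j; rewrite mnmBE mnm0E subnn.
Qed.

Lemma is_partialM f g z l v w :
  is_partial (X := X) f z l v -> is_partial (X := X) g z l w ->
  is_partial (X := X) (fun y => f y * g y) z l (v * g z + f z * w).
Proof.
move=> [P [Q [Q0 fE ->]]] [P' [Q' [Q'0 gE ->]]].
exists (P * P'), (Q * Q'); split.
- by rewrite poly_valueM mulf_neq0.
- move=> y; rewrite !poly_valueM mulf_eq0 negb_or => /andP[Qy Q'y].
  by rewrite fE // gE //; field; rewrite ?Qy ?Q'y.
- rewrite fE // gE // !mderivM !(poly_valueM, poly_valueD).
  by field; rewrite ?Q0 ?Q'0.
Qed.

Lemma is_partialD f g z l v w :
  is_partial (X := X) f z l v -> is_partial (X := X) g z l w ->
  is_partial (X := X) (fun y => f y + g y) z l (v + w).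
Proof.
move=> [P [Q [Q0 fE ->]]] [P' [Q' [Q'0 gE ->]]].
exists (P * Q' + P' * Q), (Q * Q'); split.
- by rewrite poly_valueM mulf_neq0.
- move=> y; rewrite poly_valueD !poly_valueM mulf_eq0 negb_or => /andP[Qy Q'y].
  by rewrite fE // gE //; field; rewrite ?Qy ?Q'y.
- rewrite !(mderivD, mderivM) !(poly_valueM, poly_valueD).
  by field; rewrite ?Q0 ?Q'0.
Qed.

Lemma is_partialV f z l v :
  is_partial (X := X) f z l v -> f z != 0 ->
  exists w, is_partial (X := X) (fun y => (f y)^-1) z l w.
Proof.
move=> [P [Q [Q0 fE _]]] fz.
have P0 : poly_value (X := X) P z != 0.
  by move: fz; rewrite fE // mulf_eq0 invr_eq0 (negPf Q0) orbF.
eexists; exists (Q * Q), (P * Q); split; last by [].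
  by rewrite poly_valueM mulf_neq0.
move=> y; rewrite !poly_valueM mulf_eq0 negb_or => /andP[Py Qy].
by rewrite fE //; field; rewrite ?Py ?Qy.
Qed.

Definition regular_at f z l := exists v, is_partial (X := X) f z l v.

Lemma is_partial_sum (I : Type) (r : seq I) (F : I -> 'rV[K]_N -> K) z l v :
  (forall i, is_partial (X := X) (F i) z l (v i)) ->
  is_partial (X := X) (fun y => \sum_(i <- r) F i y) z l (\sum_(i <- r) v i).
Proof.
move=> Fv; elim: r => [|i r IH].
  rewrite big_nil (_ : (fun y => _) = fun=> 0); first exact: is_partial_cst.
  by apply/funext => y; rewrite big_nil.
rewrite big_cons (_ : (fun y => _) = fun y => F i y + \sum_(i <- r) F i y).
  exact: is_partialD.
by apply/funext => y; rewrite big_cons.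
Qed.

Lemma regular_prod (I : Type) (r : seq I) (F : I -> 'rV[K]_N -> K) z l :
  (forall i, regular_at (F i) z l) ->
  regular_at (fun y => \prod_(i <- r) F i y) z l.
Proof.
move=> Fr; elim: r => [|i r [v IH]].
  exists 0; rewrite (_ : (fun y => _) = fun=> 1); first exact: is_partial_cst.
  by apply/funext => y; rewrite big_nil.
have [w Fi] := Fr i; eexists.
rewrite (_ : (fun y => _) = fun y => F i y * \prod_(i <- r) F i y).
  exact: (is_partialM Fi IH).
by apply/funext => y; rewrite big_cons.
Qed.

Lemma regular_det n (A : 'rV[K]_N -> 'M[K]_n) z l :
  (forall i j, regular_at (fun y => A y i j) z l) ->
  regular_at (fun y => \det (A y)) z l.
Proof.
move=> Ar.
suff /choice[v vP] (s : 'S_n) :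
    regular_at (fun y => (-1) ^+ s * \prod_i A y i (s i)) z l.
  by eexists; apply: is_partial_sum vP.
have [v sv] : regular_at (fun=> (-1) ^+ s) z l by eexists;
  exact: is_partial_cst.
have [w sw] : regular_at (fun y => \prod_i A y i (s i)) z l.
  by apply: regular_prod => i.
by eexists; apply: is_partialM sv sw.
Qed.

Lemma regular_invmx n (A : 'rV[K]_N -> 'M[K]_n) z l :
  (forall i j, regular_at (fun y => A y i j) z l) -> A z \in unitmx ->
  forall i j, regular_at (fun y => invmx (A y) i j) z l.
Proof.
move=> Ar Az i j; have [d dE] := regular_det Ar.
have dz : \det (A z) != 0 by move: Az; rewrite unitmxE unitfE.
have [d' d'E] := is_partialV dE dz.
have [c cE] : regular_at (fun y => cofactor (A y) j i) z l.
  have [v sv] : regular_at (fun=> (-1) ^+ (j + i)) z l.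
    by eexists; exact: is_partial_cst.
  have [w sw] : regular_at (fun y => \det (row' j (col' i (A y)))) z l.
    apply: regular_det => i' j'; have [v' v'E] := Ar (lift j i') (lift i j').
    by exists v'; rewrite (_ : (fun y => _) = fun y => A y (lift j i') (lift i
      j'))
      //; apply/funext => y; rewrite !mxE.
  by eexists; apply: is_partialM sv sw.
(* The cofactor formula holds only where the determinant is non-zero, which is a neighbourhood of
   [z]. *)
eexists; apply: (is_partial_near dE dz) (is_partialM d'E cE) => y dy.
by rewrite /invmx unitmxE unitfE dy !mxE.
Qed.

Definition mx_partial p q (A : 'rV[K]_N -> 'M[K]_(p, q)) z l (B : 'M[K]_(p, q))
  :=
  forall i j, is_partial (X := X) (fun y => A y i j) z l (B i j).

Lemma mx_partialM p q s (A : 'rV[K]_N -> 'M[K]_(p, q))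
    (B : 'rV[K]_N -> 'M[K]_(q, s)) z l dA dB :
  mx_partial A z l dA -> mx_partial B z l dB ->
  mx_partial (fun y => A y *m B y) z l (dA *m B z + A z *m dB).
Proof.
move=> hA hB i j.
have -> : (fun y => (A y *m B y) i j) = (fun y => \sum_k A y i k * B y k j).
  by apply/funext => y; rewrite mxE.
rewrite !mxE -big_split /=; apply: is_partial_sum => k.
exact: is_partialM.
Qed.

End Partials.

(** * Principal submatrices and block triangular matrices *)

Section Principal.
Variable K : fieldType.

(** Completing the block on [S] by the identity gives a triangular matrix of full size with the same
    determinant. *)
Lemma det_principal_trig n (S : {set 'I_n}) (A : 'M[K]_n) :
  is_trig_mx A -> \det (principal S A) = \prod_(k in S) A k k.
Proof.
move=> /is_trig_mxP A0.
pose B : 'M[K]_n := \matrix_(k, l)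
  if (k \in S) && (l \in S) then A k l else (k == l)%:R.
have BS : \det B = \det (principal S A) * \det (principal (~: S) (1%:M :
  'M[K]_n)).
  rewrite (@det_split _ _ S) => [|x y xS yS]; last first.
    rewrite mxE (negPf yS) andbF; case: (x =P y) => // xy.
    by rewrite -xy xS in yS.
  congr (_ * _); apply: eq_det_principal => x y; rewrite ?inE => xS yS.
    by rewrite mxE xS yS.
  by rewrite !mxE (negPf xS).
rewrite det_principal1 mulr1 in BS; rewrite -BS det_trig.
  rewrite [RHS]big_mkcond; apply: eq_bigr => k _.
  by rewrite mxE andbb eqxx; case: (k \in S).
apply/is_trig_mxP => k l kl; rewrite mxE A0 //.
by case: ifP => // _; case: (k =P l) kl => // ->; rewrite ltnn.
Qed.

Lemma principal_tr n (S : {set 'I_n}) (A : 'M[K]_n) :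
  principal S A^T = (principal S A)^T.
Proof. by apply/matrixP=> k l; rewrite !mxE. Qed.

Lemma principalM n (S : {set 'I_n}) (A B : 'M[K]_n) :
  (forall x y, x \in S -> y \notin S -> A x y = 0) ->
  principal S (A *m B) = principal S A *m principal S B.
Proof.
move=> A0; apply/matrixP => i j; rewrite !mxE.
rewrite (bigID (mem S)) /= [X in _ + X]big1 ?addr0 => [|s sS].
  by rewrite [LHS]big_enum_val /=; apply: eq_bigr => s _; rewrite !mxE.
by rewrite A0 ?mul0r ?enum_valP.
Qed.

End Principal.

Section Blocks.
Variables (K : fieldType) (n a b : nat).
Local Notation bi k := ((a <= k) + (b <= k))%N.
Implicit Types (A B G U X : 'M[K]_n) (k l : 'I_n).

(** Vectors are rows, so the matrices which preserve the flag of the first [a] and the first [b]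
    unit vectors are the block lower triangular ones. *)
Definition block_lower A := forall k l, (bi k < bi l)%N -> A k l = 0.
Definition block_upper A := forall k l, (bi l < bi k)%N -> A k l = 0.
Definition block_strict A := forall k l, ~~ (bi k < bi l)%N -> A k l = 0.
Definition block_unip A :=
  forall k l, ~~ (bi k < bi l)%N -> A k l = (k == l)%:R.

(** A representative modulo the block lower triangular matrices; this quotient models the tangent
    space of the flag variety. *)
Definition strict_part A : 'M[K]_n :=
  \matrix_(k, l) if (bi k < bi l)%N then A k l else 0.

Lemma strict_part_id A : block_strict A -> strict_part A = A.
Proof.
by move=> A0; apply/matrixP => k l; rewrite mxE; case: ifPn => // /A0 ->.
Qed.

Lemma strict_part_lower A : block_lower A -> strict_part A = 0.
Proof.
by move=> A0; apply/matrixP => k l; rewrite !mxE; case: ifP => // /A0 ->.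
Qed.

Lemma strict_partD A B : strict_part (A + B) = strict_part A + strict_part B.
Proof. by apply/matrixP => k l; rewrite !mxE; case: ifP; rewrite ?addr0. Qed.

Lemma block_strictM A B : block_strict A -> block_upper B -> block_strict (A *m
  B).
Proof.
move=> hA hB k l kl; rewrite mxE big1 // => s _.
have [ks|ks] := boolP (bi k < bi s)%N; last by rewrite hA ?mul0r.
by rewrite hB ?mulr0 // (leq_ltn_trans _ ks) // leqNgt.
Qed.

Lemma block_lowerM A B : block_lower A -> block_lower B -> block_lower (A *m B).
Proof.
move=> hA hB k l kl; rewrite mxE big1 // => s _.
have [ks|sk] := ltnP (bi k) (bi s); first by rewrite hA ?mul0r.
by rewrite hB ?mulr0 // (leq_ltn_trans sk).
Qed.

(** The part of [A] which is discarded is block lower triangular, and it remains so after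
    multiplication by [B]. *)
Lemma strict_part_mulr A B :
  block_lower B -> strict_part (strict_part A *m B) = strict_part (A *m B).
Proof.
move=> hB; apply/matrixP => k l; rewrite !mxE; case: ifP => // kl.
apply: eq_bigr => s _; have [sl|ls] := ltnP (bi s) (bi l).
  by rewrite hB ?mulr0.
by rewrite mxE (leq_trans kl ls).
Qed.

Lemma block_unip_upper A : block_unip A -> block_upper A.
Proof.
move=> hA k l lk; rewrite hA; last by rewrite -leqNgt ltnW.
by case: (k =P l) lk => // ->; rewrite ltnn.
Qed.

Lemma bi_ltn k l : (bi k < bi l)%N -> (k < l)%N.
Proof. lia. Qed.

Lemma block_unip_trig A : block_unip A -> is_trig_mx A^T.
Proof.
move=> hA; apply/is_trig_mxP => k l kl; rewrite mxE hA.
  by case: (l =P k) kl => // ->; rewrite ltnn.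
by apply/negP => /bi_ltn; rewrite ltnNge ltnW.
Qed.

Lemma det_principal_unip A (S : {set 'I_n}) :
  block_unip A -> \det (principal S A) = 1.
Proof.
move=> hA; rewrite -det_tr -principal_tr det_principal_trig.
  by rewrite big1 // => k _; rewrite mxE hA ?ltnn ?eqxx.
exact: block_unip_trig.
Qed.

Lemma det_block_unip A : block_unip A -> \det A = 1.
Proof.
move=> hA; rewrite -det_tr det_trig; last exact: block_unip_trig.
by rewrite big1 // => k _; rewrite mxE hA ?ltnn ?eqxx.
Qed.

Lemma block_unip_unit A : block_unip A -> A \in unitmx.
Proof. by move=> hA; rewrite unitmxE det_block_unip ?unitr1. Qed.

Lemma pid_mulE t A k l : ((pid_mx t : 'M_n) *m A) k l = if (k < t)%N then A k l
  else 0.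
Proof.
rewrite mxE (bigD1 k) //= big1 ?addr0 => [|s sk]; rewrite mxE.
  by rewrite eqxx; case: (k < t)%N; rewrite ?mul1r ?mul0r.
by rewrite -[(k : nat) == s]/(k == s) eq_sym (negPf sk) mul0r.
Qed.

Lemma mul_pidE t A k l : (A *m (pid_mx t : 'M_n)) k l = if (l < t)%N then A k l
  else 0.
Proof.
rewrite mxE (bigD1 l) //= big1 ?addr0 => [|s sk]; rewrite mxE.
  by rewrite eqxx; case: (l < t)%N; rewrite ?mulr1 ?mulr0.
by rewrite -[(s : nat) == l]/(s == l) (negPf sk) mulr0.
Qed.

Lemma block_lower_pid A t : t = a \/ t = b -> (a <= b)%N -> block_lower A ->
  (pid_mx t : 'M_n) *m A = (pid_mx t : 'M_n) *m A *m (pid_mx t : 'M_n).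
Proof.
move=> tab ab hA; apply/matrixP => k l; rewrite mul_pidE pid_mulE.
case: ifP => // kt; case: ltnP => // tl; apply: hA.
by case: tab => tE; subst t; lia.
Qed.

(** The hypothesis puts the first [t] rows of [A] in the span of the first [t] unit vectors; a row
    and a column with increasing block indices are separated by one of the two bounds. *)
Lemma pid_block_lower A : (a <= b)%N ->
  (forall t, t = a \/ t = b -> exists X : 'M[K]_n,
     (pid_mx t : 'M_n) *m A = X *m (pid_mx t : 'M_n)) -> block_lower A.
Proof.
move=> ab hA k l kl.
have [t tab /andP[kt tl]] : exists2 t, t = a \/ t = b & (k < t <= l)%N.
  have [ka|ak] := ltnP k a; last by exists b; [right | lia].
  by have [al|la] := leqP a l; [exists a; [left | lia] | exists b;
    [right | lia]].
have [X /(congr1 (fun Y : 'M_n => Y k l))] := hA t tab.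
by rewrite pid_mulE kt mul_pidE ltnNge tl.
Qed.

(** [A] maps the span of the first [t] unit vectors into itself, hence onto itself by equality of
    ranks, and so its inverse preserves this span as well. *)
Lemma block_lower_inv A : (a <= b <= n)%N -> A \in unitmx -> block_lower A ->
  block_lower (invmx A).
Proof.
move=> /andP[ab bn] Au hA; apply: pid_block_lower => // t tab.
have rA : \rank ((pid_mx t : 'M[K]_n) *m A) = \rank (pid_mx t : 'M[K]_n).
  by rewrite mxrankMfree ?row_free_unit.
have le : ((pid_mx t : 'M[K]_n) *m A <= (pid_mx t : 'M[K]_n))%MS.
  by rewrite (block_lower_pid tab ab hA) submxMl.
have /eqmxP eqA : ((pid_mx t : 'M[K]_n) *m A == (pid_mx t : 'M[K]_n))%MS.
  by rewrite -(mxrank_leqif_eq le) rA.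
have /submxP[X XE] : ((pid_mx t : 'M[K]_n) <= (pid_mx t : 'M[K]_n) *m A)%MS.
  by rewrite eqA.
by exists X; rewrite {1}XE mulmxA mulmxK.
Qed.

Lemma block_upper_inv A : (a <= b <= n)%N -> block_unip A ->
  block_upper (invmx A).
Proof.
move=> abn hA k l lk.
have : block_lower (invmx A^T).
  apply: block_lower_inv => //; first by rewrite unitmx_tr block_unip_unit.
  by move=> k' l' kl; rewrite mxE (block_unip_upper hA).
by move/(_ _ _ lk); rewrite -trmx_inv mxE.
Qed.

Lemma principal_lowerM t A B : t = a \/ t = b -> (a <= b)%N -> block_lower A ->
  principal [set s : 'I_n | (s < t)%N] (A *m B) =
  principal [set s : 'I_n | (s < t)%N] A *m principal [set s : 'I_n | (s <
    t)%N] B.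
Proof.
move=> tab ab hA; apply: principalM => x y; rewrite !inE -leqNgt => xt ty.
by apply: hA; case: tab => tE; subst t; lia.
Qed.

Lemma det_lower_split t A : t = a \/ t = b -> (a <= b)%N -> block_lower A ->
  \det A = \det (principal [set s : 'I_n | (s < t)%N] A)
           * \det (principal [set s : 'I_n | (t <= s)%N] A).
Proof.
move=> tab ab hA.
have -> : [set s : 'I_n | (t <= s)%N] = ~: [set s : 'I_n | (s < t)%N].
  by apply/setP => s; rewrite !inE leqNgt.
apply: det_split => x y; rewrite !inE -leqNgt => xt ty; apply: hA.
by case: tab => tE; subst t; lia.
Qed.

(** A matrix of full size which stands for the leading block of size [t], so that leading minors can
    be handled by invertibility in a fixed size. *)
Definition top_rows t A : 'M[K]_n := (pid_mx t : 'M_n) *m A + copid_mx t.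

Lemma top_rowsE t A k l :
  top_rows t A k l = if (k < t)%N then A k l else (k == l)%:R.
Proof.
rewrite /top_rows mxE pid_mulE !mxE -[(k : nat) == l]/(k == l).
by case: (k =P l) => [->|]; case: ltnP; rewrite /= ?subr0 ?subrr ?addr0 ?add0r.
Qed.

Lemma det_top_rows t A :
  \det (top_rows t A) = \det (principal [set s : 'I_n | (s < t)%N] A).
Proof.
set S := [set s : 'I_n | (s < t)%N]; rewrite (@det_split _ _ (~: S)).
  rewrite setCK [X in X * _](_ : _ = 1) ?mul1r.
    by apply: eq_det_principal => x y; rewrite inE top_rowsE => ->.
  rewrite -(det_principal1 K (~: S)); apply: eq_det_principal => x y.
  by rewrite !inE top_rowsE => /negPf ->; rewrite mxE.
move=> x y; rewrite !inE top_rowsE negbK => xt yt.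
by rewrite (negPf xt); case: (x =P y) => // xy; rewrite xy yt in xt.
Qed.

Lemma top_rows_unit t G U : t = a \/ t = b -> (a <= b <= n)%N ->
  G \in unitmx -> block_lower G -> block_unip U ->
  top_rows t (G *m U) \in unitmx.
Proof.
move=> tab abn Gu hG hU; have ab : (a <= b)%N by case/andP: abn.
have tn : (t <= n)%N by case: tab => ->; lia.
(* [P] is the inverse of the leading block of [G], completed by the identity. It turns
   [top_rows t (G *m U)] into [top_rows t U], which is upper unitriangular. *)
pose P := (pid_mx t : 'M[K]_n) *m invmx G *m pid_mx t + copid_mx t.
suff : P *m top_rows t (G *m U) \in unitmx by rewrite unitmx_mul => /andP[].
have -> : P *m top_rows t (G *m U) = top_rows t U.
  have ce := mul_copid_mx_pid K n tn; have ec := mul_pid_mx_copid K n tn.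
  have cc : copid_mx t *m copid_mx t = copid_mx t :> 'M[K]_n.
    by rewrite {2}/copid_mx mulmxBr mulmx1 ce subr0.
  have eV := block_lower_pid tab ab (block_lower_inv abn Gu hG).
  rewrite /P /top_rows -eV; move: ce ec cc eV; move: (copid_mx t) => c.
  move=> ce ec cc eV; rewrite mulmxDl !mulmxDr {2}eV cc.
  rewrite -(mulmxA _ _ c) ec mulmx0 addr0 (mulmxA c) ce mul0mx add0r.
  by rewrite !mulmxA -eV mulmxKV.
rewrite unitmxE -det_tr det_trig; last first.
  apply/is_trig_mxP => k l kl; rewrite mxE top_rowsE.
  have /is_trig_mxP/(_ _ _ kl) := block_unip_trig hU; rewrite mxE => ->.
  by case: ifP => // _; case: (l =P k) kl => // ->; rewrite ltnn.
rewrite big1 ?unitr1 // => k _; rewrite mxE top_rowsE hU ?ltnn ?eqxx //.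
by case: ifP.
Qed.

Definition row_bound (k : nat) : nat :=
  if (k < a)%N then a else if (k < b)%N then b else n.

(** Row [k] is the combination of the first [row_bound k] rows of [A] which has
    the entries of the [k]-th unit vector in the first [row_bound k] columns, so
    that this matrix is block unitriangular and spans the same flag as [A]. *)
Definition normal_form A : 'M[K]_n :=
  \matrix_(k, l) (invmx (top_rows (row_bound k) A)
                  *m ((pid_mx (row_bound k) : 'M_n) *m A)) k l.

Lemma normal_form_unip A : (a <= b <= n)%N ->
  (forall k : 'I_n, top_rows (row_bound k) A \in unitmx) ->
  block_unip (normal_form A).
Proof.
move=> abn Au k l kl; rewrite mxE.
(* After multiplication by the inverse, the first term gives the identity, and the second vanishes
   in the columns before [row_bound k]. *)
have -> : (pid_mx (row_bound k) : 'M_n) *m A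
    = top_rows (row_bound k) A - copid_mx (row_bound k) by rewrite addrK.
rewrite mulmxBr mulVmx //.
have lt : (l < row_bound k)%N.
  rewrite /row_bound; case: (ltnP k a) => ka; first lia.
  by case: (ltnP k b) => kb; [lia | exact: ltn_ord].
rewrite /copid_mx mulmxBr mulmx1 mxE [X in _ + X]mxE [X in _ - X]mxE.
by rewrite [X in _ - (_ + X)]mxE mul_pidE lt subrr subr0 mxE.
Qed.

Lemma normal_form_sub t A : t = a \/ t = b -> (a <= b <= n)%N ->
  ((pid_mx t : 'M_n) *m normal_form A <= (pid_mx t : 'M_n) *m A)%MS.
Proof.
move=> tab abn; have ab : (a <= b)%N by case/andP: abn.
apply/row_subP => k.
have [kt|tk] := ltnP k t; last first.
  rewrite (_ : row k _ = 0) ?sub0mx //.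
  by apply/rowP => l; rewrite [LHS]mxE pid_mulE ltnNge tk /= mxE.
have st : (row_bound k <= t)%N.
  rewrite /row_bound; case: (ltnP k a) => ka; first by case: tab => ->.
  by case: (ltnP k b) => kb; case: tab => tE; subst t; lia.
set s := row_bound k in st.
have -> : row k ((pid_mx t : 'M_n) *m normal_form A)
    = row k (invmx (top_rows s A)) *m ((pid_mx s : 'M_n) *m A).
  by apply/rowP => l; rewrite [LHS]mxE pid_mulE kt -row_mul !mxE.
apply: submx_trans (submxMl _ _) _.
rewrite (_ : pid_mx s = (pid_mx s : 'M_n) *m (pid_mx t : 'M_n)) ?(=^~ mulmxA,
  submxMl) //.
rewrite mul_pid_mx (minn_idPl st) (minn_idPr _) //.
by rewrite /s /row_bound; case: ifP => _; [|case: ifP]; lia.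
Qed.

End Blocks.

(** * Changes of charts on flag varieties *)

Section FlagCharts.
Variables (K : fieldType) (I : finType) (n a b : I -> nat).
Hypothesis abn : forall v, (a v <= b v <= n v)%N.
Local Notation coord := (Defs.coord n a b).
Local Notation N := #|{: coord}|.
Local Notation rV := 'rV[K]_N.
Implicit Types (c : flag_cell K n) (z : rV) (v : I).

Lemma unip_block z v : block_unip (a v) (b v) (unip z v).
Proof. by move=> k l; exact: unip0. Qed.

Lemma unip_coord z (j : 'I_N) : let e := val (enum_val j) in
  unip z (tag e) (tagged e).1 (tagged e).2 = z 0 j.
Proof.
move=> e; rewrite -[in RHS](enum_valK j) {}/e.
move: (enum_val j) => [[v [k l]] he] /=.
rewrite unipE; case: insubP => [e' _ e'E|]; last by rewrite he.
by congr (z 0 (enum_rank _)); apply: val_inj.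
Qed.

Definition coords_of (U : forall v, 'M[K]_(n v)) : rV :=
  \row_j let e := val (enum_val j) in U (tag e) (tagged e).1 (tagged e).2.

Lemma unip_coords_of (U : forall v, 'M[K]_(n v)) v :
  (forall v, block_unip (a v) (b v) (U v)) -> unip (coords_of U) v = U v.
Proof.
move=> hU; apply/matrixP => k l; rewrite unipE; case: insubP => [e _ eE|].
  by rewrite mxE enum_rankK eE.
by move/(hU v) => ->.
Qed.

Lemma adapted_basisE c c' z z' v :
  adapted_basis c z v = change_basis v c c' z z' *m adapted_basis c' z' v.
Proof. by rewrite mulmxKV // adapted_basis_unit. Qed.

Lemma change_basis_unit c c' z z' v : change_basis v c c' z z' \in unitmx.
Proof. by rewrite unitmx_mul unitmx_inv !adapted_basis_unit. Qed.

(** One inclusion suffices, because both spaces have the rank of [pid_mx t]. *)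
Lemma eq_flag_param c c' z z' :
  (forall v t, t = a v \/ t = b v ->
    ((pid_mx t : 'M_(n v)) *m adapted_basis c z v
     <= (pid_mx t : 'M_(n v)) *m adapted_basis c' z' v)%MS) ->
  flag_param c z = flag_param c' z'.
Proof.
move=> le; apply: functional_extensionality_dep => v.
have eqg t : t = a v \/ t = b v ->
    <<(pid_mx t : 'M_(n v)) *m adapted_basis c z v>>%MS
    = <<(pid_mx t : 'M_(n v)) *m adapted_basis c' z' v>>%MS.
  move=> tab; apply/genmxP; rewrite -(mxrank_leqif_eq (le v t tab)).
  by rewrite !mxrankMfree ?row_free_unit ?adapted_basis_unit.
by rewrite /flag_param; congr (_, _); apply: eqg; [left | right].
Qed.

Lemma overlapP c c' z z' :
  flag_param c z = flag_param c' z' <->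
  forall v, block_lower (a v) (b v) (change_basis v c c' z z').
Proof.
split=> [E v | low].
  have /andP[ab _] := abn v; apply: pid_block_lower => // t tab.
  have : <<(pid_mx t : 'M_(n v)) *m adapted_basis c z v>>%MS
    = <<(pid_mx t : 'M_(n v)) *m adapted_basis c' z' v>>%MS.
    have := congr1 (fun x : flags K n => x v) E; rewrite /flag_param.
    by case: tab => -> [].
  move/genmxP/eqmxP => E'.
  have /submxP[X XE] : ((pid_mx t : 'M_(n v)) *m adapted_basis c z v
    <= (pid_mx t : 'M_(n v)) *m adapted_basis c' z' v)%MS by rewrite E'.
  exists X; rewrite /change_basis; move: (adapted_basis_unit c' z' v) XE.
  move: (adapted_basis c z v) (adapted_basis c' z' v) => A A' A'u XE.
  by rewrite mulmxA XE mulmxA mulmxK.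
apply: eq_flag_param => v t tab; have /andP[ab _] := abn v.
rewrite (adapted_basisE c c' z z') mulmxA (block_lower_pid tab ab (low v)).
by rewrite -mulmxA submxMl.
Qed.

(** The basis adapted at [z], written in the basis of the chart [c']. In contrast with
    [change_basis] it involves only [z], as a polynomial, and can be differentiated directly. *)
Definition translate c c' z v : 'M[K]_(n v) :=
  adapted_basis c z v *m invmx (val (c' v)).

Lemma translateE c c' z z' v :
  translate c c' z v = change_basis v c c' z z' *m unip z' v.
Proof.
rewrite /translate (adapted_basisE c c' z z') -[LHS]mulmxA; congr (_ *m _).
by rewrite /adapted_basis mulmxK //; exact: valP.
Qed.

(** The overlap of two charts as an explicit open condition, the non-vanishing of leading minors. *)
Definition in_overlap c c' z :=
  forall v (k : 'I_(n v)),
    top_rows (row_bound (n v) (a v) (b v) k) (translate c c' z v) \in unitmx.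

Lemma overlap_in c c' z z' :
  flag_param c z = flag_param c' z' -> in_overlap c c' z.
Proof.
move=> /overlapP low v k; rewrite /row_bound.
have := @top_rows_unit K (n v) (a v) (b v) _ (change_basis v c c' z z') (unip
  z' v).
move/(_ _ _ (abn v) (change_basis_unit _ _ _ _ _) (low v) (@unip_block z' v)).
rewrite -translateE => H; case: ifP => _; first by apply: H; left.
case: ifP => _; first by apply: H; right.
rewrite /top_rows pid_mx_1 mul1mx /copid_mx pid_mx_1 subrr addr0.
by rewrite (translateE c c' z z') unitmx_mul change_basis_unit unip_unit.
Qed.

(** Block Gauss elimination gives the coordinates in the chart [c'] as rational functions of [z]. *)
Lemma in_overlap_coords c c' z : in_overlap c c' z ->
  let z' := coords_of (fun v => normal_form (a v) (b v) (translate c c' z v)) in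
  flag_param c z = flag_param c' z'.
Proof.
move=> ov z'; apply/esym/eq_flag_param => v t tab.
rewrite {1}/adapted_basis unip_coords_of; last first.
  by move=> w; apply: normal_form_unip => //; exact: ov.
rewrite mulmxA.
have nf := normal_form_sub (translate c c' z v) tab (abn v).
apply: submx_trans (submxMr (val (c' v)) nf) _.
by rewrite -mulmxA /translate mulmxKV ?submx_refl //; exact: valP.
Qed.

Lemma change_coordsE c c' z z' : flag_param c z = flag_param c' z' ->
  change_coords (X := flag_variety K n a b) c c' z = z'.
Proof.
move=> E; rewrite /change_coords.
have := @xgetPex _ 0 [set y | flag_param c z = flag_param c' y] (ex_intro _ z'
  E).
by rewrite /= {1}E => /flag_param_inj <-.
Qed.

End FlagCharts.

(** * The differential of a change of coordinates *)

Section Jacobian.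
Variables (K : numFieldType) (I : finType) (n a b : I -> nat).
Hypothesis abn : forall v, (a v <= b v <= n v)%N.
Local Notation coord := (Defs.coord n a b).
Local Notation N := #|{: coord}|.
Local Notation X := (flag_variety K n a b).
Implicit Types (c : flag_cell K n) (z : 'rV[K]_N) (v : I).

(** The partial derivative of [unip] along the coordinate [l]: an elementary matrix at one factor of
    the product and 0 at the others. *)
Definition coord_delta (l : 'I_N) v : 'M[K]_(n v) :=
  \matrix_(k, j)
    (Tagged (fun w => ('I_(n w) * 'I_(n w))%type) (k, j)
     == val (enum_val l))%:R.

Lemma coord_delta_strict (l : 'I_N) v :
  block_strict (a v) (b v) (coord_delta l v).
Proof.
move=> k j kj; rewrite mxE; case: eqP => // E.
by have := valP (enum_val l); rewrite -E /is_coord /= (negPf kj).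
Qed.

Lemma mx_partial_unip z l v :
  mx_partial (X := X) (fun y => unip y v) z l (coord_delta l v).
Proof.
move=> k j; rewrite mxE.
rewrite (_ : (fun y => _) = fun y : 'rV_N =>
  if (insub (Tagged (fun w => ('I_(n w) * 'I_(n w))%type) (k, j)) : option
    coord)
    is Some e then y 0 (enum_rank e) else (k == j)%:R); last first.
  by apply/funext => y; rewrite unipE.
case: insubP => [e _ eE|kj].
  rewrite -eE (inj_eq val_inj) -[e](enum_rankK) (inj_eq enum_val_inj)
    enum_rankK.
  exact: (@is_partial_coord K X).
have [E|_] := eqVneq (Tagged (fun w => ('I_(n w) * 'I_(n w))%type) (k, j))
  (val (enum_val l)); last exact: (@is_partial_cst K X).
by move: kj; rewrite E (valP (enum_val l)).
Qed.

Definition mx_regular p q (A : 'rV[K]_N -> 'M[K]_(p, q)) z l :=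
  exists B, mx_partial (X := X) A z l B.

Lemma mx_regularP p q (A : 'rV[K]_N -> 'M[K]_(p, q)) z l :
  (forall i j, regular_at (X := X) (fun y => A y i j) z l) -> mx_regular A z l.
Proof.
move=> Ar; have /choice[B BE] : forall i, exists Bi : 'I_q -> K, forall j,
    is_partial (X := X) (fun y => A y i j) z l (Bi j).
  by move=> i; have [Bi hBi] := choice (Ar i); exists Bi.
by exists (\matrix_(i, j) B i j) => i j; rewrite mxE.
Qed.

Lemma mx_regularM p q s (A : 'rV[K]_N -> 'M[K]_(p, q))
    (B : 'rV[K]_N -> 'M[K]_(q, s)) z l :
  mx_regular A z l -> mx_regular B z l ->
  mx_regular (fun y => A y *m B y) z l.
Proof. by move=> [dA hA] [dB hB]; eexists; exact: mx_partialM hA hB. Qed.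

Lemma mx_partial_cst p q (A : 'M[K]_(p, q)) z l :
  mx_partial (X := X) (fun=> A) z l 0.
Proof. by move=> i j; rewrite mxE; exact: is_partial_cst. Qed.

Lemma mx_regular_cst p q (A : 'M[K]_(p, q)) z l : mx_regular (fun=> A) z l.
Proof. by exists 0; exact: mx_partial_cst. Qed.

Lemma mx_partial_uniq p q (A : 'rV[K]_N -> 'M[K]_(p, q)) z l B B' :
  mx_partial (X := X) A z l B -> mx_partial (X := X) A z l B' -> B = B'.
Proof.
by move=> h h'; apply/matrixP => i j; apply: is_partial_uniq (h i j) (h' i j).
Qed.

Section Derivative.
Variables (c c' : flag_cell K n) (z z' : 'rV[K]_N) (l : 'I_N).
Hypothesis zz' : flag_param c z = flag_param c' z'.

Let cc y : 'rV[K]_N := change_coords (X := X) c c' y.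

Let ccz : cc z = z'. Proof. exact: change_coordsE. Qed.

(** A single regular function whose non-vanishing locus is the overlap, in the form required by
    [is_partial_near]. *)
Let guard (y : 'rV[K]_N) : K := \prod_v \prod_(k < n v)
  \det (top_rows (row_bound (n v) (a v) (b v) k) (translate c c' y v)).

Let guardP y : (guard y != 0) <-> in_overlap (a := a) (b := b) c c' y.
Proof.
split=> [/prodf_neq0 g v k | ov].
  have /prodf_neq0 := g v isT; move/(_ k isT).
  by rewrite unitmxE unitfE.
apply/prodf_neq0 => v _; apply/prodf_neq0 => k _.
by have := ov v k; rewrite unitmxE unitfE.
Qed.

Let translate_regular v : mx_regular (fun y => translate c c' y v) z l.
Proof.
apply: mx_regularM; last exact: mx_regular_cst.
apply: mx_regularM; last exact: mx_regular_cst.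
by eexists; exact: mx_partial_unip.
Qed.

Let top_rows_regular v t i j :
  regular_at (X := X) (fun y => top_rows t (translate c c' y v) i j) z l.
Proof.
have [B hB] := translate_regular v.
case: (ltnP i t) => it.
  exists (B i j); rewrite (_ : (fun y => _) = fun y => translate c c' y v i j)
    //.
  by apply/funext => y; rewrite top_rowsE it.
exists 0; rewrite (_ : (fun y => _) = fun=> (i == j)%:R);
  first exact: is_partial_cst.
by apply/funext => y; rewrite top_rowsE ltnNge it.
Qed.

Let guard_regular : regular_at (X := X) guard z l.
Proof.
apply: regular_prod => v; apply: regular_prod => k.
exact: regular_det (top_rows_regular _).
Qed.

Let guardz : guard z != 0.
Proof. by apply/guardP; exact: overlap_in zz'. Qed.

Let near_z (f f' : 'rV[K]_N -> K) (v : K) : (forall y, in_overlap (a := a) (b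
  := b) c c' y -> f y = f' y) ->
  is_partial (X := X) f z l v -> is_partial (X := X) f' z l v.
Proof.
have [w gw] := guard_regular => ff'; apply: is_partial_near gw guardz _ => y.
by move/guardP; exact: ff'.
Qed.

Let unip_cc y v : in_overlap (a := a) (b := b) c c' y ->
  unip (cc y) v = normal_form (a v) (b v) (translate c c' y v).
Proof.
move=> ov; rewrite /cc (change_coordsE (in_overlap_coords abn ov)).
by apply: unip_coords_of => w; apply: normal_form_unip => //; exact: ov.
Qed.

Let unip_cc_regular v : mx_regular (fun y => unip (cc y) v) z l.
Proof.
apply: mx_regularP => i j.
set t := row_bound (n v) (a v) (b v) i.
have [B hB] : mx_regular (fun y => invmx (top_rows t (translate c c' y v))) z l.
  apply: mx_regularP; apply: regular_invmx (top_rows_regular _) _.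
  exact: (overlap_in abn zz').
have [C hC] := mx_regularM (mx_regular_cst (pid_mx t : 'M_(n v)) z l)
  (translate_regular v).
eexists; apply: (near_z _ (mx_partialM hB hC i j)) => y ov.
by rewrite (unip_cc _ ov) [RHS]mxE.
Qed.

(** From U h = G U' h' one obtains dU U^-1 G = dG + G dU' U'^-1. As G is block lower triangular on
    the whole overlap, so is dG, and G^-1 dG has no strictly upper part; dU' U'^-1 equals its own
    strictly upper part because U' is block unitriangular. *)
Lemma partial_unip_change_coords v :
  let G := change_basis v c c' z z' in
  mx_partial (X := X) (fun y => unip (cc y) v) z l
    (strict_part (a v) (b v) (invmx G *m coord_delta l v *m invmx (unip z v) *m
      G)
     *m unip z' v).
Proof.
move=> G; have [dU hU] := unip_cc_regular v.
have Gu : G \in unitmx by exact: change_basis_unit.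
have Glow : block_lower (a v) (b v) G by have /(overlapP abn) := zz'.
have U'u := unip_unit z' v; have Uu := unip_unit z v.
have dUs : block_strict (a v) (b v) dU.
  move=> i j ij; apply: is_partial_uniq (hU i j) _.
  rewrite (_ : (fun y => _) = fun=> (i == j)%:R); first exact: is_partial_cst.
  by apply/funext => y; rewrite unip0.
pose g y := change_basis v c c' y (cc y).
have [dG hG] : mx_regular g z l.
  apply: mx_regularM.
    apply: mx_regularM; last exact: mx_regular_cst.
    by eexists; exact: mx_partial_unip.
  have [B hB] := mx_regularM (unip_cc_regular v) (mx_regular_cst (val (c' v)) z
    l).
  apply: mx_regularP; apply: regular_invmx => [i j|]; first by exists (B i j).
  exact: adapted_basis_unit.
have dGl : block_lower (a v) (b v) dG.
  move=> i j ij; apply: is_partial_uniq (hG i j) _.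
  apply: (near_z _ (@is_partial_cst K X 0 z l)) => y ov; apply/esym.
  have := in_overlap_coords abn ov => E; rewrite /g /cc (change_coordsE E).
  by move/(overlapP abn): E => /(_ v i j ij).
have gz : g z = G by rewrite /g ccz.
have E1 := mx_partialM (@mx_partial_unip z l v) (mx_partial_cst (val (c v)) z
  l).
have E2 := mx_partialM hG (mx_partialM hU (mx_partial_cst (val (c' v)) z l)).
(* This identity holds at every [y], also outside the overlap, so the two expressions have the same
   partial derivatives. *)
have gE : (fun y => unip y v *m val (c v))
    = (fun y => g y *m (unip (cc y) v *m val (c' v))).
  by apply/funext => y; exact: adapted_basisE.
rewrite gE in E1; have := mx_partial_uniq E1 E2.
rewrite !mulmx0 !addr0 gz ccz => E.
have cE : unip z v *m val (c v) = G *m (unip z' v *m val (c' v)).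
  exact: adapted_basisE.
clearbody G.
(* The constant basis h is eliminated as U^-1 G U' h', after which h' cancels on the right. *)
have {}cE : val (c v) = invmx (unip z v) *m G *m unip z' v *m val (c' v).
  by rewrite -!mulmxA -cE mulKmx.
have {}E : coord_delta l v *m invmx (unip z v) *m G = dG + G *m dU *m invmx
  (unip z' v).
  have c'u : val (c' v) \in unitmx by exact: valP.
  move: E; rewrite cE !mulmxA -mulmxDl.
  move/(congr1 (fun A => A *m invmx (val (c' v)))); rewrite !mulmxK //.
  move/(congr1 (fun A => A *m invmx (unip z' v))).
  by rewrite mulmxDl !mulmxK.
suff -> : strict_part (a v) (b v) (invmx G *m coord_delta l v *m invmx (unip z
  v) *m G) *m unip z' v = dU by [].
rewrite -!mulmxA in E *; rewrite E mulmxDr strict_partD strict_part_lower;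
  last first.
  by apply: block_lowerM => //; apply: block_lower_inv.
rewrite add0r mulKmx // strict_part_id ?mulmxKV //.
by apply: block_strictM => //; apply: block_upper_inv => //; exact: unip_block.
Qed.

End Derivative.

End Jacobian.

(** * The canonical bundle of a flag variety *)

Lemma sum_in_range n a b :
  (\sum_(k < n) (a <= k < b) = minn b n - minn a n)%N.
Proof.
elim: n => [|n IH]; first by rewrite big_ord0 !minn0.
rewrite big_ord_recr /= IH; case: andP => [[? ?]|?] /=; lia.
Qed.

Section BlockProducts.
Variables (K : fieldType) (n a b : nat).
Hypothesis abn : (a <= b <= n)%N.
Local Notation bi k := ((a <= k) + (b <= k))%N.

Lemma det_principal_empty (S : {set 'I_n}) (A : 'M[K]_n) :
  S =i finset.set0 -> \det (principal S A) = 1.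
Proof.
move=> S0; have -> : S = finset.set0 by apply/setP.
rewrite -(det_principal1 K (finset.set0 : {set 'I_n})).
by apply: eq_det_principal => x y; rewrite inE.
Qed.

(** The columns beyond the block of [k] start at [a] for the [a] rows of the first block, at [b] for
    the [b - a] rows of the second, and there are none for the last. *)
Lemma prod_det_cols (A : 'M[K]_n) :
  \prod_(k < n) \det (principal [set l : 'I_n | (bi k < bi l)%N] A) =
  \det (principal [set l : 'I_n | (a <= l)%N] A) ^+ a
  * \det (principal [set l : 'I_n | (b <= l)%N] A) ^+ (b - a).
Proof.
set P := \det _; set Q := \det _.
transitivity (\prod_(k < n) (P ^+ (0 <= k < a)%N * Q ^+ (a <= k < b)%N)).
  apply: eq_bigr => k _; have [ka|ak] := ltnP k a.
    rewrite /= mulr1; congr (\det (principal _ A)); apply/setP => l;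
      rewrite !inE.
    by apply/idP/idP; lia.
  rewrite /= mul1r; have [kb|bk] := ltnP k b.
    congr (\det (principal _ A)); apply/setP => l; rewrite !inE.
    by apply/idP/idP; lia.
  apply: det_principal_empty => l; rewrite !inE; apply/negbTE; lia.
rewrite big_split /= -!expr_sum !sum_in_range.
by congr (_ ^+ _ * _ ^+ _); [have := sum_in_range n 0 a => /= ->; lia | lia].
Qed.

(** The rows before the block of [l] are the first [a] for the [b - a] columns of the second block,
    the first [b] for the [n - b] columns of the last, and there are none for the first. *)
Lemma prod_det_rows (A : 'M[K]_n) :
  \prod_(l < n) \det (principal [set k : 'I_n | (bi k < bi l)%N] A) =
  \det (principal [set k : 'I_n | (k < a)%N] A) ^+ (b - a)
  * \det (principal [set k : 'I_n | (k < b)%N] A) ^+ (n - b).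
Proof.
set P := \det _; set Q := \det _.
transitivity (\prod_(l < n) (P ^+ (a <= l < b)%N * Q ^+ (b <= l < n)%N)).
  apply: eq_bigr => l _; have ln := ltn_ord l; rewrite ln andbT.
  have [la|al] := ltnP l a.
    have -> : (b <= l)%N = false by lia.
    rewrite /= mulr1; apply: det_principal_empty => k; rewrite !inE;
      apply/negbTE; lia.
  have [lb|bl] := ltnP l b.
    rewrite /= mulr1; congr (\det (principal _ A)); apply/setP => k;
      rewrite !inE.
    by apply/idP/idP; lia.
  rewrite /= mul1r; congr (\det (principal _ A)); apply/setP => k; rewrite !inE.
  by apply/idP/idP; lia.
rewrite big_split /= -!expr_sum !sum_in_range.
by congr (_ ^+ _ * _ ^+ _); lia.
Qed.

End BlockProducts.

(** Here x and y stand for the minors of sizes a and b and g for the full determinant, so that g / x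
    and g / y are the complementary minors; the left side is the inverse of the jacobian determinant
    at one factor. *)
Lemma flag_canonical_weight (K : fieldType) (x y g : K) (a b n : nat) :
  (a <= b <= n)%N -> x != 0 -> y != 0 -> g != 0 ->
  (x^-1 ^+ (b - a) * y^-1 ^+ (n - b) * ((g / x) ^+ a * (g / y) ^+ (b - a)))^-1
  = x ^+ b * y ^+ (n - a) / g ^+ b.
Proof.
move=> /andP[ab bn] x0 y0 g0.
have -> : b = (a + (b - a))%N by lia.
have -> : (n - a = (b - a) + (n - b))%N by lia.
have -> : (a + (b - a) - a = b - a)%N by lia.
have -> : (n - (a + (b - a)) = n - b)%N by lia.
rewrite !exprMn !exprVn !exprD.
move: (expf_neq0 a x0) (expf_neq0 (b - a) x0) (expf_neq0 (b - a) y0).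
move: (expf_neq0 (n - b) y0) (expf_neq0 a g0) (expf_neq0 (b - a) g0).
move: (x ^+ a) (x ^+ (b - a)) (y ^+ (b - a)) (y ^+ (n - b)) (g ^+ a) (g ^+ (b -
  a)).
move=> x1 x2 y1 y2 g1 g2 y20 g10 g20 x10 x20 y10.
by field; rewrite x10 x20 y10 y20 g10 g20.
Qed.

(** * The jacobian determinant as the determinant of a conjugation *)

Section CoordOp.
Variables (K : numFieldType) (I : finType) (n a b : I -> nat).
Hypothesis abn : forall v, (a v <= b v <= n v)%N.
Local Notation coord := (Defs.coord n a b).
Local Notation N := #|{: coord}|.
Local Notation X := (flag_variety K n a b).
Implicit Types (c : flag_cell K n) (z : 'rV[K]_N) (v : I).
Local Notation delta := (@coord_delta K I n a b).
Implicit Types (Phi Psi : forall v, 'M[K]_(n v) -> 'M[K]_(n v)).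

(** The matrix, in the basis [coord_delta], of [Phi] followed by the projection
    to the strictly upper block parts. *)
Definition coord_op Phi : 'M[K]_N :=
  \matrix_(i, j) let e := val (enum_val j) in
    Phi (tag e) (delta i (tag e)) (tagged e).1 (tagged e).2.

Lemma eq_coord_op Phi Psi :
  (forall v i, Phi v (delta i v) = Psi v (delta i v)) ->
  coord_op Phi = coord_op Psi.
Proof. by move=> E; apply/matrixP => i j; rewrite [LHS]mxE [RHS]mxE; cbv zeta;
  rewrite E. Qed.

Lemma sum_coord_delta (A : forall v, 'M[K]_(n v)) v :
  \sum_(j < N) (let e := val (enum_val j) in A (tag e) (tagged e).1 (tagged
    e).2)
    *: delta j v = strict_part (a v) (b v) (A v).
Proof.
apply/matrixP => k l; rewrite summxE mxE; case: ifPn => kl.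
  pose e : coord := exist _ (Tagged (fun w => ('I_(n w) * 'I_(n w))%type) (k,
    l)) kl.
  rewrite (bigD1 (enum_rank e)) //= big1 ?addr0 => [|j je].
    by rewrite !mxE enum_rankK /= eqxx mulr1.
  rewrite !mxE; case: eqP => [E|_]; last by rewrite mulr0.
  case/eqP: je; rewrite -[j]enum_valK; congr (enum_rank _).
  by apply: val_inj; rewrite -E.
rewrite big1 // => j _; rewrite !mxE; case: eqP => [E|_]; last by rewrite mulr0.
by have := valP (enum_val j); rewrite -E /is_coord /= /block_index (negPf kl).
Qed.

(** With row vectors [Phi] acts first, and taking coordinates in between projects its value to the
    strictly upper blocks. *)
Lemma coord_opM Phi Psi : (forall v, linear (Psi v)) ->
  coord_op Phi *m coord_op Psi
  = coord_op (fun v A => Psi v (strict_part (a v) (b v) (Phi v A))).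
Proof.
move=> lin; apply/matrixP => i j; rewrite !mxE; cbv zeta.
set v := tag _; set k := _.1; set l := _.2.
rewrite -[strict_part _ _ _](sum_coord_delta (fun v => Phi v (delta i v)) v).
have Psi_sum (r : seq 'I_N) (F : 'I_N -> K) :
    Psi v (\sum_(s <- r) F s *: delta s v)
    = \sum_(s <- r) F s *: Psi v (delta s v).
  elim: r => [|s r IH]; last by rewrite !big_cons lin IH.
  by rewrite !big_nil; have := lin v (-1) 0 0;
    rewrite scaler0 addr0 scaleN1r addNr.
rewrite Psi_sum summxE; apply: eq_bigr => s _.
by rewrite !mxE.
Qed.

Lemma coord_delta_mulE (i : 'I_N) v (A : 'M[K]_(n v)) k l :
  (delta i v *m A) k l = \sum_s
    (Tagged (fun w => ('I_(n w) * 'I_(n w))%type) (k, s) == val (enum_val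
      i))%:R * A s l.
Proof. by rewrite mxE; apply: eq_bigr => s _; rewrite mxE. Qed.

Definition coord_row (i : 'I_N) : {v : I & 'I_(n v)} :=
  let e := val (enum_val i) in Tagged (fun v => 'I_(n v)) (tagged e).1.

Definition coord_col (i : 'I_N) : {v : I & 'I_(n v)} :=
  let e := val (enum_val i) in Tagged (fun v => 'I_(n v)) (tagged e).2.

(** Right multiplication acts on every row separately; on row [k] the free entries lie in the
    columns of the later blocks, so the action there is a principal block of [A v]. *)
Lemma det_coord_op_mulr (A : forall v, 'M[K]_(n v)) :
  \det (coord_op (fun v M => M *m A v)) = \prod_v \prod_(k < n v)
    \det (principal [set l : 'I_(n v) |
      ((a v <= k) + (b v <= k) < (a v <= l) + (b v <= l))%N] (A v)).
Proof.
rewrite (det_fibers (f := coord_row)); last first.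
  move=> i j ij; rewrite mxE; cbv zeta; rewrite mxE big1 // => s _; rewrite mxE.
  case: eqP => [E|_]; last by rewrite mul0r.
  by case/eqP: ij; rewrite /coord_row -E.
rewrite sig_big_dep /=; apply: eq_bigr => -[v k] _ /=.
set S := [set l : 'I_(n v) | (_ + _ < _ + _)%N].
have coordP (l : 'I_#|S|) :
    is_coord a b (Tagged (fun w => ('I_(n w) * 'I_(n w))%type) (k, enum_val l)).
  by have := enum_valP l; rewrite inE.
pose f l : 'I_N := enum_rank (exist (is_coord a b) _ (coordP l) : coord).
have f_inj : injective f.
  move=> l l' /enum_rank_inj /(congr1 val) /= /eqP.
  by rewrite -tag_eqE /tag_eq eqxx tagged_asE /= => /eqP[] /enum_val_inj.
rewrite -(det_mxsub_image _ f_inj).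
  congr (\det _); apply/matrixP => l l'; rewrite mxE mxE; cbv zeta;
    rewrite enum_rankK /=.
  rewrite coord_delta_mulE enum_rankK (bigD1 (enum_val l)) //= eqxx mul1r.
  rewrite big1 ?addr0 ?mxE // => s sl; case: eqP => [/eqP|_];
    last by rewrite mul0r.
  rewrite -tag_eqE /tag_eq eqxx tagged_asE /= => /eqP[] E.
  by rewrite E eqxx in sl.
move=> e; rewrite inE; apply/codomP/eqP => [[l ->]|].
  by rewrite /coord_row enum_rankK.
rewrite /coord_row /f -[e]enum_valK; move: (enum_val e) => [[w [k' l]] kl] /=.
rewrite enum_rankK /= => /eqP; rewrite -tag_eqE /tag_eq /= => /andP[/eqP wv].
subst w; rewrite tagged_asE => /eqP kk; subst k'.
have lS : l \in S by rewrite inE.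
exists (enum_rank_in lS l); congr (enum_rank _); apply: val_inj => /=.
by rewrite enum_rankK_in.
Qed.

Lemma det_coord_op_mull (A : forall v, 'M[K]_(n v)) :
  \det (coord_op (fun v M => A v *m M)) = \prod_v \prod_(l < n v)
    \det (principal [set k : 'I_(n v) |
      ((a v <= k) + (b v <= k) < (a v <= l) + (b v <= l))%N] (A v)).
Proof.
rewrite (det_fibers (f := coord_col)); last first.
  move=> i j ij; rewrite mxE; cbv zeta; rewrite mxE big1 // => s _; rewrite mxE.
  case: eqP => [E|_]; last by rewrite mulr0.
  by case/eqP: ij; rewrite /coord_col -E.
rewrite sig_big_dep /=; apply: eq_bigr => -[v l] _ /=.
set S := [set k : 'I_(n v) | (_ + _ < _ + _)%N].
have coordP (k : 'I_#|S|) :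
    is_coord a b (Tagged (fun w => ('I_(n w) * 'I_(n w))%type) (enum_val k, l)).
  by have := enum_valP k; rewrite inE.
pose f k : 'I_N := enum_rank (exist (is_coord a b) _ (coordP k) : coord).
have f_inj : injective f.
  move=> k k' /enum_rank_inj /(congr1 val) /= /eqP.
  by rewrite -tag_eqE /tag_eq eqxx tagged_asE /= => /eqP[] /enum_val_inj.
rewrite -(det_mxsub_image _ f_inj).
  (* Left multiplication acts on a column through the transpose in the row vector convention. *)
  rewrite -[RHS]det_tr; congr (\det _); apply/matrixP => k k'.
  rewrite mxE mxE; cbv zeta; rewrite enum_rankK /= mxE.
  rewrite (bigD1 (enum_val k)) //= mxE enum_rankK eqxx mulr1.
  rewrite big1 ?addr0 ?mxE // => s sk; rewrite mxE enum_rankK.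
  case: eqP => [/eqP|_]; last by rewrite mulr0.
  rewrite -tag_eqE /tag_eq eqxx tagged_asE /= => /eqP[] E.
  by rewrite E eqxx in sk.
move=> e; rewrite inE; apply/codomP/eqP => [[k ->]|].
  by rewrite /coord_col enum_rankK.
rewrite /coord_col /f -[e]enum_valK; move: (enum_val e) => [[w [k l']] kl] /=.
rewrite enum_rankK /= => /eqP; rewrite -tag_eqE /tag_eq /= => /andP[/eqP wv].
subst w; rewrite tagged_asE => /eqP ll; subst l'.
have kS : k \in S by rewrite inE.
exists (enum_rank_in kS k); congr (enum_rank _); apply: val_inj => /=.
by rewrite enum_rankK_in.
Qed.

(** In the formula for dU', the factors U^-1 and U' are right multiplications by block unitriangular
    matrices, of determinant 1; left multiplication by G^-1 and right multiplication by G remain. *)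
Lemma det_jacobian c c' z z' : flag_param c z = flag_param c' z' ->
  \det (jacobian (X := X) c c' z)
  = \det (coord_op (fun v M => invmx (change_basis v c c' z z') *m M))
    * \det (coord_op (fun v M => M *m change_basis v c c' z z')).
Proof.
move=> zz'; pose G v := change_basis v c c' z z'.
have Glow := (overlapP abn c c' z z').1 zz'.
have JE : jacobian (X := X) c c' z = coord_op (fun v M =>
    strict_part (a v) (b v) (invmx (G v) *m M *m invmx (unip z v) *m G v)
    *m unip z' v).
  apply/matrixP => i j; rewrite !mxE; apply: partialE.
  have := partial_unip_change_coords abn i zz' (v := tag (val (enum_val j)))
    (tagged (val (enum_val j))).1 (tagged (val (enum_val j))).2.
  by congr is_partial; apply/funext => y; rewrite unip_coord.
have detU (y : 'rV[K]_N) : \det (coord_op (fun v M => M *m unip y v)) = 1.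
  rewrite det_coord_op_mulr big1 // => v _; rewrite big1 // => k _.
  exact: det_principal_unip (@unip_block _ _ _ _ _ y v).
have lin_mulr v (B : 'M[K]_(n v)) : linear (fun M : 'M[K]_(n v) => M *m B).
  by move=> x M M'; rewrite mulmxDl scalemxAl.
rewrite -[LHS]mul1r -(detU z) -[RHS]mulr1 -(detU z') -!det_mulmx.
congr (\det _); rewrite coord_opM // coord_opM // JE coord_opM; last first.
  move=> v x M M'; rewrite mulmxDr -scalemxAr !mulmxDl -!scalemxAl.
  rewrite strict_partD mulmxDl; congr (_ + _).
  rewrite [RHS]scalemxAl; congr (_ *m _).
  by apply/matrixP => k l; rewrite !mxE; case: ifP; rewrite ?mulr0.
apply: eq_coord_op => v i; congr (_ *m _).
rewrite [strict_part _ _ (_ *m unip z v)]strict_part_id; last first.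
  apply: block_strictM; first exact: coord_delta_strict.
  exact: block_unip_upper (@unip_block _ _ _ _ _ z v).
rewrite strict_part_mulr //; congr (strict_part _ _ (_ *m _)).
by rewrite -!mulmxA mulmxV ?unip_unit ?mulmx1.
Qed.

Lemma canonical_bundleE c c' z z' : flag_param c z = flag_param c' z' ->
  canonical_bundle X c c' z z' = \prod_v
    (\det (sub_block [set s : 'I_(n v) | (s < a v)%N] (change_basis v c c' z
      z')) ^+ b v
     * \det (sub_block [set s : 'I_(n v) | (s < b v)%N] (change_basis v c c' z
       z'))
         ^+ (n v - a v)
     / \det (change_basis v c c' z z') ^+ b v).
Proof.
move=> zz'; have Glow := (overlapP abn c c' z z').1 zz'.
rewrite /canonical_bundle /det_bundle /= det_tr det_inv (det_jacobian zz').
rewrite det_coord_op_mulr det_coord_op_mull -big_split /= -prodfV.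
apply: eq_bigr => v _; move: (Glow v) (change_basis_unit c c' z z' v).
rewrite prod_det_rows // prod_det_cols //.
move: (change_basis v c c' z z') => G low Gu.
have /andP[ab bn] := abn v.
have split t (tab : t = a v \/ t = b v) := det_lower_split tab ab low.
(* Leading blocks multiply when the left factor is block lower triangular; this is applied to G G^-1
   = 1. *)
have inv t : t = a v \/ t = b v ->
    \det (principal [set s : 'I_(n v) | (s < t)%N] (invmx G))
    = (\det (principal [set s : 'I_(n v) | (s < t)%N] G))^-1.
  move=> tab; have := congr1 determinant (principal_lowerM (invmx G) tab ab
    low).
  rewrite mulmxV // det_principal1 det_mulmx => /esym E.
  by apply: (mulfI (x := \det (principal [set s : 'I_(n v) | (s < t)%N] G)));
    [apply: contra_eq_neq E => ->; rewrite mul0r eq_sym oner_eq0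
    |rewrite E divff //; apply: contra_eq_neq E => ->;
      rewrite mul0r eq_sym oner_eq0].
have Ga := split (a v) (or_introl erefl);
  have Gb := split (b v) (or_intror erefl).
have G0 : \det G != 0 by move: Gu; rewrite unitmxE unitfE.
rewrite (inv _ (or_introl erefl)) (inv _ (or_intror erefl)).
have := G0; rewrite {1}Ga mulf_eq0 negb_or => /andP[x0 qa0].
have := G0; rewrite {1}Gb mulf_eq0 negb_or => /andP[y0 qb0].
have qaE : \det (principal [set s : 'I_(n v) | (a v <= s)%N] G)
   = \det G / \det (principal [set s : 'I_(n v) | (s < a v)%N] G).
  by rewrite Ga mulrAC divff // mul1r.
have qbE : \det (principal [set s : 'I_(n v) | (b v <= s)%N] G)
   = \det G / \det (principal [set s : 'I_(n v) | (s < b v)%N] G).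
  by rewrite Gb mulrAC divff // mul1r.
rewrite qaE qbE (_ : sub_block _ G = principal [set s : 'I_(n v) | (s < a v)%N]
  G) //.
rewrite (_ : sub_block _ G = principal [set s : 'I_(n v) | (s < b v)%N] G) //.
exact: flag_canonical_weight.
Qed.

End CoordOp.

(** * Isomorphisms of line bundles on a flag variety *)

Section NonvanishingPolynomials.
Variables (K : numClosedFieldType) (X : atlas K).

(** On the line from 0 to [z] the polynomial has no zeros over an algebraically closed field, hence
    is constant. *)
Lemma poly_value_nonvanishing (h : {mpoly K[coords X]}) :
  (forall z, poly_value (X := X) h z != 0) ->
  forall z, poly_value (X := X) h z = poly_value (X := X) h 0.
Proof.
move=> h0 z; have [c _ hc] : exists2 c, c != 0 &
    forall t, (line_poly 0 z h).[t] = c.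
  by apply: poly_nonvanishing_const => t; rewrite horner_line_poly; exact: h0.
transitivity c; last first.
  by rewrite -(hc 0) horner_line_poly scale0r addr0.
by rewrite -(hc 1) horner_line_poly scale1r add0r.
Qed.

End NonvanishingPolynomials.

(** * Leading minors along a curve crossing two charts *)

Section Swap.
Variables (K : fieldType) (n : nat) (k l : 'I_n).
Hypothesis kl : (l = k.+1 :> nat)%N.

(** On the rows and columns [k], [l] this is the matrix with rows (t, 1) and (1, 0), and elsewhere
    the identity: only the leading minor of size [l] varies with [t]. *)
Definition swap_mx (t : K) : 'M[K]_n := (1%:M + t *: delta_mx k l) *m tperm_mx
  k l.

Lemma swap_mxE t (i j : 'I_n) :
  swap_mx t i j = (tperm k l i == j)%:R + t * ((i == k) && (j == k))%:R.
Proof.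
rewrite /swap_mx mulmxDl mul1mx -scalemxAl !mxE (bigD1 l) //= big1 ?addr0.
  by rewrite !mxE eqxx andbT tpermR eq_sym -mulnb natrM [(k == j)]eq_sym.
by move=> s sl; rewrite !mxE (negPf sl) andbF mul0r.
Qed.

Lemma det_principal_swap_eq t :
  \det (principal [set s : 'I_n | (s < l)%N] (swap_mx t)) = t.
Proof.
have E : {in [set s : 'I_n | (s < l)%N] &, forall x y,
    swap_mx t x y = (1%:M + (t - 1) *: delta_mx k k : 'M_n) x y}.
  move=> x y; rewrite !inE swap_mxE !mxE => xl yl.
  have [->|xk] := eqVneq x k; last first.
    rewrite tpermD ?(eq_sym k) // 1?eq_sym; first by rewrite !mulr0.
    by apply: contraTneq xl => ->; rewrite ltnn.
  rewrite tpermL; have -> : (l == y) = false.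
    by apply: contraTF yl => /eqP <-; rewrite ltnn.
  have [_|_] := eqVneq y k; rewrite ?mulr1 ?mulr0 ?addr0 //=.
  by rewrite add0r addrC subrK.
rewrite (eq_det_principal E) det_principal_trig; last first.
  apply/is_trig_mxP => i j ij; rewrite !mxE.
  case: (i =P j) ij => [->|_]; first by rewrite ltnn.
  case: (i =P k) => [->|_]; rewrite ?andbF ?mulr0 ?addr0 //= => ij.
  by case: (j =P k) ij => [->|_]; rewrite ?ltnn // mulr0 addr0.
rewrite (bigD1 k) /=; last by rewrite inE kl.
rewrite big1 ?mulr1 => [|s /andP[_ sk]]; last first.
  by rewrite !mxE eqxx (negPf sk) mulr0 addr0.
by rewrite !mxE !eqxx mulr1 addrC subrK.
Qed.

(** For [tau <= k] the block is the identity. For [tau > l] it contains both indices, and swap_mx u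
    times swap_mx 0 is 1 + u E_kl, of determinant 1; comparing u = t with u = 0 gives the
    equality. *)
Lemma det_principal_swap_neq (tau : nat) t : tau != l :> nat ->
  \det (principal [set s : 'I_n | (s < tau)%N] (swap_mx t))
  = \det (principal [set s : 'I_n | (s < tau)%N] (swap_mx 0))
  /\ \det (principal [set s : 'I_n | (s < tau)%N] (swap_mx 0)) != 0.
Proof.
move=> tl; set S := [set s : 'I_n | _].
have [lt|tl'] := ltnP l tau; last first.
  have tk : (tau <= k)%N by move: tl tl'; rewrite kl; lia.
  have E u : \det (principal S (swap_mx u)) = 1.
    rewrite -[RHS](det_principal1 K S); apply: eq_det_principal => x y.
    rewrite !inE swap_mxE mxE => xt yt.
    have [xk|xk] := eqVneq x k; first by move: xt; rewrite xk ltnNge tk.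
    have [xl|xl] := eqVneq x l; first by move: xt; rewrite xl ltnNge tl'.
    by rewrite tpermD ?mulr0 ?addr0 // eq_sym.
  by rewrite !E oner_eq0.
have kt : (k < tau)%N by move: lt; rewrite kl; lia.
have split u : \det (principal S (swap_mx u)) * \det (principal S (swap_mx 0))
  = 1.
  have -> : 1 = \det (principal S ((1%:M + u *: delta_mx k l) : 'M[K]_n)).
    rewrite -det_tr -principal_tr det_principal_trig.
      rewrite big1 // => s _; rewrite !mxE eqxx.
      case: (s =P k) => [->|_]; last by rewrite mulr0 addr0.
      case: (k =P l) => [E|_]; last by rewrite mulr0 addr0.
      by move: kl; rewrite -E; lia.
    apply/is_trig_mxP => i j ij; rewrite !mxE.
    case: (j =P i) ij => [->|_]; first by rewrite ltnn.
    case: (j =P k) => [->|_]; last by rewrite mulr0 addr0.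
    by case: (i =P l) => [->|_]; rewrite ?mulr0 ?addr0 // kl; lia.
  rewrite -det_mulmx; congr (\det _).
  have -> : 1%:M + u *: delta_mx k l = swap_mx u *m swap_mx 0 :> 'M[K]_n.
    rewrite /swap_mx scale0r addr0 mul1mx -mulmxA /tperm_mx -perm_mxM tperm2.
    by rewrite perm_mx1 mulmx1.
  apply/esym/principalM => x s; rewrite !inE swap_mxE -leqNgt => xt ts.
  have -> : (tperm k l x == s) = false.
    apply/negP => /eqP E; move: ts; rewrite -E leqNgt.
    by case: tpermP => [_|_|_ _]; rewrite ?lt ?kt ?xt.
  have -> : (s == k) = false by apply/negP => /eqP E; move: ts; rewrite E; lia.
  by rewrite andbF mulr0 addr0.
have /eqP := split 0; have /eqP := split t => E0 E1.
have N0 : \det (principal S (swap_mx 0)) != 0.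
  by apply: contra_eq_neq (eqP E1) => ->; rewrite mul0r eq_sym oner_eq0.
split=> //; apply: (mulIf N0); by rewrite (eqP E0) (eqP E1).
Qed.

End Swap.

(** * Line bundles given by powers of the tautological minors *)

Section FlagLineBundles.
Variables (K : numClosedFieldType) (I : finType) (n a b : I -> nat).
Hypothesis abn : forall v, (a v <= b v <= n v)%N.
Local Notation coord := (Defs.coord n a b).
Local Notation N := #|{: coord}|.
Local Notation X := (flag_variety K n a b).
Implicit Types (c : flag_cell K n) (z : 'rV[K]_N) (v : I).

Definition minor t c c' z z' v : K :=
  \det (sub_block [set s : 'I_(n v) | (s < t)%N] (change_basis v c c' z z')).

(** The common form of det W and K_F; the last factor is constant on each overlap and is absorbed by
    the constants of an isomorphism. *)
Definition flag_bundle (ex ey eg : I -> nat) : lbundle X := fun c c' z z' =>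
  \prod_v (minor (a v) c c' z z' v ^+ ex v * minor (b v) c c' z z' v ^+ ey v
           / \det (change_basis v c c' z z') ^+ eg v).

(** Right multiplication by the unitriangular [unip z' v] preserves leading minors, so they can be
    computed without knowing [z']. *)
Lemma minorE t c c' z z' v : flag_param c z = flag_param c' z' ->
  t = a v \/ t = b v ->
  minor t c c' z z' v
  = \det (principal [set s : 'I_(n v) | (s < t)%N] (translate c c' z v)).
Proof.
move=> zz' tab; have /andP[ab _] := abn v.
rewrite (translateE c c' z z') (principal_lowerM _ tab ab); last first.
  exact: (overlapP abn c c' z z').1 zz' v.
by rewrite det_mulmx (det_principal_unip _ (@unip_block _ _ _ _ _ z' v)) mulr1.
Qed.

(** The unipotent factors have determinant 1, so only the determinants of the two fixed bases
    remain. *)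
Lemma det_change_basis c c' z z' v :
  \det (change_basis v c c' z z') * \det (val (c' v)) = \det (val (c v)).
Proof.
have detU (y : 'rV[K]_N) : \det (unip y v) = 1.
  exact: det_block_unip (@unip_block _ _ _ _ _ y v).
have detA c0 (y : 'rV[K]_N) : \det (adapted_basis c0 y v) = \det (val (c0 v)).
  by rewrite det_mulmx detU mul1r.
by rewrite -(detA c z) (adapted_basisE c c' z z') [RHS]det_mulmx detA.
Qed.

Lemma minor0 c c' z z' v : minor 0 c c' z z' v = 1.
Proof. by apply: det_principal_empty => s; rewrite !inE. Qed.

Lemma flag_bundle_canonical (ex ey eg : I -> nat) (L : lbundle X) :
  (forall c c' z z', flag_param c z = flag_param c' z' ->
     L c c' z z' = flag_bundle ex ey eg c c' z z') ->
  (forall v, a v = 0%N \/ ex v = b v) -> (forall v, ey v = n v - a v)%N ->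
  lbundle_iso L (canonical_bundle X).
Proof.
move=> LE exE eyE.
(* These constants turn the power [eg v] of the determinant of the change of basis into the power
   [b v] of the canonical bundle. *)
pose h c : K := \prod_v (\det (val (c v)) ^+ b v / \det (val (c v)) ^+ eg v).
have c0 c v : \det (val (c v)) != 0.
  by have := valP (c v); rewrite unitmxE unitfE.
exists (fun c => (h c)%:MP); split=> [c z | c c' z z' zz'].
  rewrite /poly_value mevalC; apply/prodf_neq0 => v _.
  by rewrite mulf_neq0 ?invr_eq0 ?expf_neq0.
rewrite /poly_value !mevalC LE // (canonical_bundleE abn zz') -!big_split /=.
apply: eq_bigr => v _;
  rewrite -/(minor (a v) c c' z z' v) -/(minor (b v) c c' z z' v).
rewrite eyE; have -> : minor (a v) c c' z z' v ^+ ex v = minor (a v) c c' z z'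
  v ^+ b v.
  by case: (exE v) => ->; rewrite // minor0 !expr1n.
have g0 : \det (change_basis v c c' z z') != 0.
  by have := change_basis_unit c c' z z' v; rewrite unitmxE unitfE.
rewrite -(det_change_basis c c' z z') !exprMn; move: (c0 c' v) g0.
move: (\det _) (\det _) (minor _ _ _ _ _ _ ^+ _) (minor _ _ _ _ _ _ ^+ _).
move=> g e x y e0 g0.
move: (expf_neq0 (b v) e0) (expf_neq0 (eg v) e0) (expf_neq0 (b v) g0).
move: (expf_neq0 (eg v) g0).
move: (g ^+ _) (g ^+ _) (e ^+ _) (e ^+ _) => u1 u2 u3 u4 u10 u30 u40 u20.
by field; rewrite ?u10 ?u20 ?u30 ?u40.
Qed.

Lemma unip_line (e : 'I_N) t v :
  unip (t *: delta_mx 0 e) v = 1%:M + t *: coord_delta K e v :> 'M[K]_(n v).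
Proof.
apply/matrixP => i j; rewrite unipE !mxE; case: insubP => [f fij fE|ij].
  rewrite !mxE eqxx /= (_ : (i == j) = false) ?add0r.
    by rewrite -fE (inj_eq val_inj) -[in RHS](inj_eq enum_rank_inj) enum_valK.
  by apply: contraTF fij => /eqP ->; rewrite /is_coord ltnn.
have [E|_] := eqVneq (Tagged (fun w => ('I_(n w) * 'I_(n w))%type) (i, j))
  (val (enum_val e)); last by rewrite mulr0 addr0.
by move: ij; rewrite E (valP (enum_val e)).
Qed.

(** The value at 1 gives x = y, and the value at 2 then gives p = q in characteristic zero. *)
Lemma expr_injective (p q : nat) (x y : K) : x != 0 ->
  (forall t, t != 0 -> t ^+ p * x = t ^+ q * y) -> p = q.
Proof.
move=> x0 E; have := E 1 (oner_neq0 _); rewrite !expr1n !mul1r => xy.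
have /E : 2%:R != 0 :> K by rewrite pnatr_eq0.
rewrite -xy => /(mulIf x0) /eqP; rewrite -!natrX eqr_nat => /eqP.
by move/eqP; rewrite eqn_exp2l // => /eqP.
Qed.

Section SwapChart.
Variables (v0 : I) (k l : 'I_(n v0)).
Hypotheses (kl : l = k.+1 :> nat) (lab : l = a v0 :> nat \/ l = b v0 :> nat).
Hypothesis ab : (a v0 < b v0)%N.

Definition unit_chart : flag_cell K n := fun v => exist _ 1%:M (unitmx1 K (n
  v)).

Definition swap_chart : flag_cell K n :=
  dfwith unit_chart (exist _ (tperm_mx k l) (unitmx_perm K (tperm k l))).

(** The index [l] opens a block and [k] closes the preceding one. *)
Lemma swap_is_coord : is_coord a b (Tagged (fun w => ('I_(n w) * 'I_(n
  w))%type) (k, l)).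
Proof. by rewrite /is_coord /= /block_index; case: lab; lia. Qed.

Definition swap_coord : 'I_N := enum_rank (exist (is_coord a b) _ swap_is_coord
  : coord).

Definition swap_point (t : K) : 'rV[K]_N := t *: delta_mx 0 swap_coord.

Lemma translate_swap t :
  translate swap_chart unit_chart (swap_point t) v0 = swap_mx k l t.
Proof.
rewrite /translate /adapted_basis unip_line /= invmx1 mulmx1 /swap_chart
  dfwith_in /=.
congr ((_ + _ *: _) *m _); apply/matrixP => i j.
rewrite !mxE enum_rankK /= -tag_eqE /tag_eq eqxx tagged_asE /=.
by rewrite xpair_eqE.
Qed.

Lemma translate_unit t v : v0 != v ->
  translate swap_chart unit_chart (swap_point t) v = 1%:M.
Proof.
move=> vv; rewrite /translate /adapted_basis unip_line /= invmx1 mulmx1.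
rewrite /swap_chart dfwith_out //= mulmx1 -[RHS]addr0; congr (_ + _).
rewrite (_ : coord_delta _ _ _ = 0) ?scaler0 //; apply/matrixP => i j.
rewrite !mxE enum_rankK /= -tag_eqE /tag_eq /= eq_sym.
by rewrite (negPf vv).
Qed.

Lemma swap_overlap t : t != 0 -> exists z',
  flag_param swap_chart (swap_point t) = flag_param unit_chart z'.
Proof.
move=> t0; eexists; apply: in_overlap_coords => // v.
have [<-|vv] := eqVneq v0 v => i; rewrite unitmxE unitfE det_top_rows.
  rewrite translate_swap; set tau := row_bound _ _ _ _.
  have [->|tl] := eqVneq tau l; first by rewrite det_principal_swap_eq.
  by have [-> N0] := det_principal_swap_neq kl t tl.
by rewrite translate_unit // det_principal1 oner_eq0.
Qed.

Lemma swap_minors (ex ey eg : I -> nat) t z' :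
  flag_param swap_chart (swap_point t) = flag_param unit_chart z' ->
  flag_bundle ex ey eg swap_chart unit_chart (swap_point t) z'
  = \det (principal [set s : 'I_(n v0) | (s < a v0)%N] (swap_mx k l t)) ^+ ex v0
    * \det (principal [set s : 'I_(n v0) | (s < b v0)%N] (swap_mx k l t)) ^+ ey
      v0
    / \det (tperm_mx k l : 'M[K]_(n v0)) ^+ eg v0.
Proof.
move=> zz'; have dE v := det_change_basis swap_chart unit_chart (swap_point t)
  z' v.
rewrite /flag_bundle (bigD1 v0) //= [X in _ * X]big1 ?mulr1 => [|v vv].
  rewrite !(minorE zz') ?translate_swap; [|by right|by left].
  have := dE v0; rewrite det1 mulr1 => ->; rewrite /swap_chart dfwith_in.
  by [].
rewrite eq_sym in vv; rewrite !(minorE zz') ?translate_unit //;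
  [|by right|by left].
have := dE v; rewrite det1 mulr1 => ->; rewrite /swap_chart dfwith_out //=.
by rewrite !det_principal1 det1 !expr1n divr1 mulr1.
Qed.

End SwapChart.

(** The vectors on both sides of the bound a v are exchanged for the first exponent, those on both
    sides of b v for the second; they exist when 0 < a v, respectively b v < n v. Since a v < b v,
    only one of the two minors varies with t. *)
Lemma flag_bundle_canonical_weights (ex ey eg : I -> nat) (L : lbundle X) v :
  (forall c c' z z', flag_param c z = flag_param c' z' ->
     L c c' z z' = flag_bundle ex ey eg c c' z z') ->
  lbundle_iso L (canonical_bundle X) -> (a v < b v)%N ->
  ((0 < a v)%N -> ex v = b v) /\ ((b v < n v)%N -> ey v = n v - a v)%N.
Proof.
move=> LE [h [h0 hE]] ab; have /andP[_ bn] := abn v.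
have hc c z : poly_value (X := X) (h c) z = poly_value (X := X) (h c) 0.
  exact: poly_value_nonvanishing (h0 c) z.
have key (k l : 'I_(n v)) (kl : l = k.+1 :> nat) (lab : l = a v :> nat \/ l = b
  v :> nat) :
    exists2 x : K * K, x.1 != 0 & forall t, t != 0 ->
    let A := \det (principal [set s : 'I_(n v) | (s < a v)%N] (swap_mx k l t))
      in
    let B := \det (principal [set s : 'I_(n v) | (s < b v)%N] (swap_mx k l t))
      in
    A ^+ b v * B ^+ (n v - a v) * x.1 = A ^+ ex v * B ^+ ey v * x.2.
  set c := swap_chart k l; set c' := unit_chart.
  set s := \det (tperm_mx k l : 'M[K]_(n v)).
  have s0 : s != 0 by have := unitmx_perm K (tperm k l); rewrite unitmxE unitfE.
  (* The constants consist of the values of the isomorphism on the two charts and of powers of the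
     determinant of the transposition. *)
  exists (poly_value (X := X) (h c) 0 / s ^+ b v, (s ^+ eg v)^-1 * poly_value
    (X := X) (h c') 0).
    by rewrite mulf_neq0 ?invr_eq0 ?expf_neq0.
  move=> t t0 A B; have [z' zz'] := swap_overlap kl lab ab t0.
  have := hE c c' _ _ zz'; rewrite LE // (canonical_bundleE abn zz') !hc.
  rewrite (swap_minors ex ey eg zz').
  have := swap_minors b (fun v => n v - a v)%N b zz'.
  rewrite /flag_bundle /minor => ->.
  by rewrite -/A -/B -/s => E /=; rewrite !mulrA -E; ring.
split=> [a0|bn'].
  have ln : (a v < n v)%N by exact: leq_trans ab bn.
  have kn : ((a v).-1 < n v)%N by lia.
  have kl : Ordinal ln = (Ordinal kn).+1 :> nat by rewrite /= prednK.
  have [[x y] /= x0 E] := key _ _ kl (or_introl erefl).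
  have bl : b v != Ordinal ln :> nat by rewrite /= gtn_eqF.
  have [_ B0] := det_principal_swap_neq (K := K) kl 0 bl.
  (* The minor of size [b v] does not depend on [t], so its powers join the constants. *)
  apply/esym; apply: expr_injective (mulf_neq0 (expf_neq0 (n v - a v) B0) x0) _.
  move=> t t0; have := E t t0; rewrite (det_principal_swap_eq kl t).
  have [-> _] := det_principal_swap_neq kl t bl.
  by rewrite -!mulrA => Et; exact: Et.
have kn : ((b v).-1 < n v)%N by lia.
have kl : Ordinal bn' = (Ordinal kn).+1 :> nat by rewrite /= prednK //; lia.
have [[x y] /= x0 E] := key _ _ kl (or_intror erefl).
have al : a v != Ordinal bn' :> nat by rewrite /= ltn_eqF.
have [_ A0] := det_principal_swap_neq (K := K) kl 0 al.
apply/esym; apply: expr_injective (mulf_neq0 (expf_neq0 (b v) A0) x0) _.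
move=> t t0; have := E t t0; rewrite (det_principal_swap_eq kl t).
have [-> _] := det_principal_swap_neq kl t al.
by rewrite ![_ * t ^+ _]mulrC -!mulrA => Et; exact: Et.
Qed.

End FlagLineBundles.

(** * The bundle W *)

Lemma card_ord_lt n k : (k <= n)%N -> #|[set s : 'I_n | (s < k)%N]| = k.
Proof.
move=> kn; rewrite -sum1_card big_mkcond /=.
transitivity (\sum_(i < n) (0 <= i < k))%N; last by rewrite sum_in_range; lia.
by apply: eq_bigr => i _; rewrite inE leq0n; case: ltnP.
Qed.

Lemma card_ord_ge n k : #|[set s : 'I_n | (k <= s)%N]| = (n - k)%N.
Proof.
rewrite -sum1_card big_mkcond /=.
transitivity (\sum_(i < n) (k <= i < n))%N; last by rewrite sum_in_range; lia.
by apply: eq_bigr => i _; rewrite inE ltn_ord andbT; case: leqP.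
Qed.

Section DetBundles.
Variables (K : fieldType) (X : atlas K) (c c' : cell X) (z z' : 'rV[K]_(coords
  X)).
Local Notation dt E := (det_bundle E c c' z z').

Lemma det_sum_bundle (E E' : vbundle X) :
  dt (sum_bundle E E') = dt E * dt E'.
Proof. exact: det_ublock. Qed.

Lemma det_trivial_bundle k : dt (trivial_bundle k) = 1.
Proof. exact: det1. Qed.

Lemma det_hom_bundle (E E' : vbundle X) :
  dt (tensor_bundle (dual_bundle E) E')
  = (dt E)^-1 ^+ rank E' * dt E' ^+ rank E.
Proof. by rewrite /det_bundle /= det_tens det_tr det_inv. Qed.

Lemma det_big_sum_bundle (r : seq nat) (E : nat -> vbundle X) :
  dt (\big[@sum_bundle K X/trivial_bundle 0]_(i <- r) E i)
  = \prod_(i <- r) dt (E i).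
Proof.
apply: (big_morph (fun E => dt E)) => [E1 E2|]; first exact: det_sum_bundle.
exact: det_trivial_bundle.
Qed.

End DetBundles.

Lemma prod_odd_even (R : comPzRingType) (T : nat -> R) k :
  \prod_(v < k.*2.+1) T v.+1
  = T 1%N * \prod_(1 <= i < k.+1) (T i.*2 * T i.*2.+1).
Proof.
rewrite -(big_mkord xpredT (fun v => T v.+1)).
elim: k => [|k IH]; first by rewrite big_nat1 big_geq // mulr1.
rewrite doubleS big_nat_recr //= big_nat_recr //= IH.
by rewrite [in RHS]big_nat_recr //= -!mulrA doubleS.
Qed.

(** * The exponents of det W at the vertices and their comparison with those of K_F *)

Section Quiver.
Variables (K : numClosedFieldType) (k : nat) (d r p q : nat -> nat).
Local Notation m := k.+1.
Variable phi : quiver_rep K d.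
Hypothesis hphi : has_ranks m r p q phi.

(** The existence of [phi] yields the inequalities that make the truncated differences of dimensions
    exact. *)
Lemma rank_odd i : (1 <= i <= m)%N -> (r i.*2.-1 <= d i.*2.-1)%N.
Proof. by case: hphi => h _ _ _ /h <-; exact: rank_leq_row. Qed.

Lemma rank_even i : (1 <= i < m)%N ->
  [/\ r i.*2 <= p i, r i.*2.-1 <= p i, p i <= d i.*2 & r i.*2 <= d i.*2.+1]%N.
Proof.
move=> im; case: hphi => /(_ i) h1 /(_ i im) <- /(_ i im) <- _.
rewrite -h1; last by case/andP: im => -> /ltnW ->.
split; [exact: mxrankS (addsmxSr _ _)|exact: mxrankS (addsmxSl _ _)
       |exact: rank_leq_col|exact: rank_leq_row].
Qed.

Lemma rank_ker i : (1 <= i < m)%N ->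
  (q i <= d i.*2.+1 - r i.*2.+1)%N.
Proof.
move=> im; case: hphi => /(_ i.+1) h1 _ _ /(_ i im) <-.
have := h1 _; rewrite /= => /(_ _) <-; last by case/andP: im => _ ->.
by rewrite -mxrank_ker mxrankS // capmxSl.
Qed.

Lemma rank_odd_succ i : (1 <= i < m)%N -> (r i.*2.+1 <= d i.*2.+1)%N.
Proof. by move=> im; have := @rank_odd i.+1; rewrite doubleS /=; apply;
  lia. Qed.

Lemma vertex_cases (P : nat -> Prop) : P 1%N ->
  (forall i, (1 <= i < m)%N -> P i.*2) ->
  (forall i, (1 <= i < m)%N -> P i.*2.+1) ->
  forall j, (1 <= j <= k.*2.+1)%N -> P j.
Proof.
move=> P1 Pe Po j j1; rewrite -(odd_double_half j).
have := odd_double_half j; case: (odd j) => /= jE.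
  have [->|h0] := posnP j./2; first exact: P1.
  by rewrite add1n; apply: Po; lia.
by rewrite add0n; apply: Pe; lia.
Qed.

Lemma step1_even i : (0 < i)%N -> step1 r q i.*2 = r i.*2.
Proof. by move=> i0; rewrite /step1 odd_double; case: i i0. Qed.
Lemma step1_odd i : (0 < i)%N -> step1 r q i.*2.+1 = q i.
Proof. by move=> i0; rewrite /step1 /= odd_double /= uphalf_double;
  case: i i0. Qed.
Lemma step2_even i : step2 d r p i.*2 = p i.
Proof. by rewrite /step2 odd_double doubleK. Qed.
Lemma step2_odd i : step2 d r p i.*2.+1 = (d i.*2.+1 - r i.*2.+1)%N.
Proof. by rewrite /step2 /= odd_double. Qed.

Lemma steps_le j : (1 <= j <= k.*2.+1)%N ->
  (step1 r q j <= step2 d r p j <= d j)%N.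
Proof.
apply: (vertex_cases (P := fun j => step1 r q j <= step2 d r p j <= d j)%N)
  => [|i im|i im]; first by rewrite /= leq_subr.
  have i0 : (0 < i)%N by case/andP: im.
  by have [h1 _ h2 _] := rank_even im; rewrite step1_even // step2_even h1.
have i0 : (0 < i)%N by case/andP: im.
by rewrite step1_odd // step2_odd rank_ker // leq_subr.
Qed.

Local Notation dim := (@Defs.dim m d).
Local Notation dim1 := (@Defs.dim1 m r q).
Local Notation dim2 := (@Defs.dim2 m d r p).

Lemma dims_le (v : vertex m) : (dim1 v <= dim2 v <= dim v)%N.
Proof. by apply: steps_le; rewrite /=; exact: ltn_ord v. Qed.

(** The rank of the bundle tensored with the dual of V_(2i-1)/U_(2i-1,2) in W. *)
Definition top_rank i : nat := if i == m then d m.*2 else p i.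

(** The exponents at the vertex [j] of the three functions [minor] (for U_(j,1)
    and U_(j,2)) and [1 / \det change_basis] in det W. *)
Definition weight1 j : nat :=
  if odd j then if j == 1%N then 0%N else r j.-1 else (d j.+1 - q j./2)%N.
Definition weight2 j : nat := if odd j then top_rank j./2.+1 else r j.-1.
Definition weight_dim j : nat :=
  if odd j then (weight1 j + weight2 j)%N else 0%N.

(** The determinant of Hom(Q, E) is det Q to the power - rk E times det E to the power rk Q, and det
    (V / U) is the determinant of the change of basis divided by the minor of U. *)
Lemma det_W (c c' : cell (F K m d r p q)) z z' : param c z = param c' z' ->
  det_bundle (W K m d r p q) c c' z z'
  = flag_bundle (fun v : vertex m => weight1 v.+1) (fun v => weight2 v.+1)
      (fun v => weight_dim v.+1) c c' z z'.
Proof.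
move=> zz'.
pose x j := minor (step1 r q j) c c' z z' (vtx m j).
pose y j := minor (step2 d r p j) c c' z z' (vtx m j).
pose g j := \det (change_basis (vtx m j) c c' z z').
have vtxE j : (1 <= j <= k.*2.+1)%N -> (vtx m j).+1 = j.
  by move=> /andP[j0 jk]; rewrite inordK ?prednK // prednK.
have low v := (overlapP dims_le c c' z z').1 zz' v.
have quot t j : t = dim1 (vtx m j) \/ t = dim2 (vtx m j) ->
    \det (sub_block [set s : 'I_(dim (vtx m j)) | (t <= s)%N]
            (change_basis (vtx m j) c c' z z'))
    = g j / minor t c c' z z' (vtx m j).
  move=> tab; have /andP[ab _] := dims_le (vtx m j).
  have gE := det_lower_split tab ab (low (vtx m j)).
  have : g j != 0.
    by have := change_basis_unit c c' z z' (vtx m j); rewrite unitmxE unitfE.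
  rewrite /g gE mulf_eq0 negb_or => /andP[t0 _].
  by rewrite mulrAC -[minor _ _ _ _ _ _]/(\det (principal _ _)) divff ?mul1r.
have quot1 j : (1 <= j <= k.*2.+1)%N ->
    det_bundle (VmodU1 K m d r p q j) c c' z z' = g j / x j.
  by move=> jk; apply: quot; left; rewrite /Defs.dim1 vtxE.
have quot2 j : (1 <= j <= k.*2.+1)%N ->
    det_bundle (VmodU2 K m d r p q j) c c' z z' = g j / y j.
  by move=> jk; apply: quot; right; rewrite /Defs.dim2 vtxE.
have rkU1 j : (1 <= j <= k.*2.+1)%N -> rank (U1 K m d r p q j) = step1 r q j.
  move=> jk; rewrite /= card_ord_lt // /Defs.dim vtxE //.
  by have /andP[h1 h2] := steps_le jk; exact: leq_trans h1 h2.
have rkU2 j : (1 <= j <= k.*2.+1)%N -> rank (U2 K m d r p q j) = step2 d r p j.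
  move=> jk; rewrite /= card_ord_lt // /Defs.dim vtxE //.
  by have /andP[_] := steps_le jk.
have rkQ1 j : (1 <= j <= k.*2.+1)%N ->
    rank (VmodU1 K m d r p q j) = (d j - step1 r q j)%N.
  by move=> jk; rewrite /= card_ord_ge /Defs.dim vtxE.
have rkQ2 j : (1 <= j <= k.*2.+1)%N ->
    rank (VmodU2 K m d r p q j) = (d j - step2 d r p j)%N.
  by move=> jk; rewrite /= card_ord_ge /Defs.dim vtxE.
pose T j := x j ^+ weight1 j * y j ^+ weight2 j / g j ^+ weight_dim j.
have -> : flag_bundle (fun v : vertex m => weight1 v.+1) (fun v => weight2 v.+1)
    (fun v => weight_dim v.+1) c c' z z' = \prod_(v < k.*2.+1) T v.+1.
  apply: eq_bigr => v _; rewrite /T /x /y /g (_ : vtx m v.+1 = v) //.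
  exact: inord_val.
rewrite prod_odd_even /W det_sum_bundle det_big_sum_bundle.
rewrite /Hom_bundle det_hom_bundle det_trivial_bundle expr1n mulr1 quot2;
  last by lia.
have -> : T 1%N = (y 1%N / g 1%N) ^+ top_rank 1.
  by rewrite /T /weight_dim /= expr0 mul1r add0n expr_div_n.
(* The first product collects the quotients V_(2i-1) / U_(2i-1,2) for all i up to m, the summand
   with V_(2m) included; the second collects the other factors. *)
transitivity (\prod_(1 <= i < m.+1) (y i.*2.-1 / g i.*2.-1) ^+ top_rank i
  * \prod_(1 <= i < m) (y i.*2 ^+ r i.*2.-1 *
      ((x i.*2.+1 / g i.*2.+1) ^+ r i.*2 * x i.*2 ^+ (d i.*2.+1 - q i)))).
  rewrite [X in _ = X * _]big_nat_recr //= [RHS]mulrAC [RHS]mulrC -big_split /=.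
  rewrite /top_rank eqxx.
  rewrite invf_div; congr (_ * _); apply: eq_big_nat => i im.
  have i0 : (0 < i)%N by case/andP: im.
  rewrite det_sum_bundle !det_hom_bundle quot2 ?quot1; [|lia|lia].
  rewrite rkU2 ?rkQ2 ?rkU1 ?rkQ1; try lia.
  have -> : (i == k.+1) = false by lia.
  rewrite !invf_div step1_even // step2_even step1_odd //.
  (* The rank of V_(2i-1) / U_(2i-1,2), where the truncated subtraction is exact because r_(2i-1) <=
     d_(2i-1). *)
  have -> : (d i.*2.-1 - step2 d r p i.*2.-1 = r i.*2.-1)%N.
    have -> : i.*2.-1 = i.-1.*2.+1 by lia.
    rewrite step2_odd subKn //.
    by have := @rank_odd i; rewrite (_ : i.*2.-1 = i.-1.*2.+1); [apply;
      lia|lia].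
  by rewrite -[LHS]mulrA.
(* Vertex 1 is split off and the index shifted, so that the vertices 2i and 2i+1 are treated
   together. *)
rewrite big_ltn // big_add1 /= -mulrA -big_split /=; congr (_ * _).
apply: eq_big_nat => i im; have i0 : (0 < i)%N by case/andP: im.
rewrite /T /weight_dim /weight1 /weight2 /= !odd_double /= expr0 divr1.
rewrite doubleK uphalf_double eqSS double_eq0 -[i == 0%N]negbK -lt0n i0 /=.
rewrite exprD !expr_div_n invfM.
ring.
Qed.

(** The right-hand sides are the exponents of K_F, dim U_(j,2) and dim V_j - dim U_(j,1). At vertex
    1 the subbundle U_(1,1) = 0 has minor 1, so its exponent is free. *)
Definition weights_match := forall j, (1 <= j <= k.*2.+1)%N ->
  (j = 1%N \/ weight1 j = step2 d r p j) /\ weight2 j = (d j - step1 r q j)%N.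

Lemma weights_match_crepant : weights_match -> crepant K m d r p q.
Proof.
move=> wm; have hj (v : vertex m) : (1 <= v.+1 <= k.*2.+1)%N by exact: ltn_ord
  v.
apply: (flag_bundle_canonical dims_le det_W) => v;
  last by have [_] := wm _ (hj v).
have [[v1|w1] _] := wm _ (hj v); [left | by right].
by rewrite /Defs.dim1 v1.
Qed.

Hypothesis hp : forall i, (1 <= i < m)%N -> p i <> r i.*2.-1 /\ p i <> r i.*2.
Hypothesis hq : forall i, (1 <= i < m)%N ->
  ((q i)%:Z <> (d i.*2.+1)%:Z - (r i.*2.+1)%:Z) /\
  ((q i)%:Z <> (d i.*2.+1)%:Z - (r i.*2)%:Z).

Lemma crepant_weights_match : proper_flags m d r p q ->
  crepant K m d r p q -> weights_match.
Proof.
case=> h1 h2 h3 cr j jk.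
have vE : (vtx m j).+1 = j.
  by case/andP: jk => j0 jk; rewrite inordK ?prednK // prednK.
(* The strict inclusion of U_(j,1) in U_(j,2) combines the rank inequalities with the assumptions on
   p and q. *)
have step_lt : (step1 r q j < step2 d r p j)%N.
  move: j jk {vE}; apply: (vertex_cases (P := fun j => step1 r q j < step2 d r
    p j)%N)
    => [|i im|i im]; first by case/andP: h1.
    have i0 : (0 < i)%N by case/andP: im.
    rewrite step1_even // step2_even.
    by have [a _ _ _] := rank_even im; have [_ b] := hp im; lia.
  have i0 : (0 < i)%N by case/andP: im.
  rewrite step1_odd // step2_odd.
  by have a := rank_ker im; have a' := rank_odd_succ im; have [b _] := hq im;
    lia.
have [] := @flag_bundle_canonical_weights _ _ _ _ _ dims_le _ _ _ _ (vtx m j)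
  det_W cr.
  by rewrite /Defs.dim1 /Defs.dim2 vE.
rewrite /Defs.dim1 /Defs.dim2 /Defs.dim vE => H1 H2.
have [s1 s2] : (j = 1%N \/ 0 < step1 r q j)%N /\ (step2 d r p j < d j)%N.
  move: j jk {vE step_lt H1 H2}.
  apply: (vertex_cases (P := fun j => (j = 1%N \/ 0 < step1 r q j)%N
    /\ (step2 d r p j < d j)%N)) => [|i im|i im].
  - by split; [left | case/andP: h1].
  - by have [] := h2 i im; split; [right |].
  - by have [] := h3 i im; split; [right |].
split; last exact: H2.
by case: s1 => [->|/H1]; [left | right].
Qed.

(** The vertices 2i and 2i+1 give p_i = d_(2i+1) - q_i = [top_rank i.+1], while vertex 1 gives
    [top_rank 1] = d_1; the remaining equations are r_(j-1) = d_j - r_j for 2 <= j <= 2m-1. *)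
Lemma weights_matchP : weights_match <->
  [/\ d 1%N = d m.*2,
      forall i : nat, (1 <= i < m)%N -> p i = d 1%N,
      forall i : nat, (1 <= i < m)%N ->
        (q i)%:Z = (d i.*2.+1)%:Z - (d 1%N)%:Z
    & forall i : nat, (1 <= i <= m.*2 - 2)%N ->
        (r i)%:Z = (d i.+1)%:Z - (r i.+1)%:Z].
Proof.
have wodd i : (1 <= i < m)%N ->
    weight1 i.*2.+1 = r i.*2 /\ weight2 i.*2.+1 = top_rank i.+1.
  move=> im; rewrite /weight1 /weight2 /= odd_double /= uphalf_double.
  by rewrite eqSS double_eq0; case: i im.
have weven i : (1 <= i < m)%N ->
    weight1 i.*2 = (d i.*2.+1 - q i)%N /\ weight2 i.*2 = r i.*2.-1.
  by move=> im; rewrite /weight1 /weight2 /= odd_double /= doubleK.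
split=> [wm | [dE pE qE rE]].
  have top1 : top_rank 1 = d 1%N.
    by have [_] := wm 1%N isT; rewrite /weight2 /= subn0.
  have even i : (1 <= i < m)%N ->
      (d i.*2.+1 - q i = p i /\ r i.*2.-1 = d i.*2 - r i.*2)%N.
    move=> im; have i0 : (0 < i)%N by case/andP: im.
    have ik : (1 <= i.*2 <= k.*2.+1)%N by lia.
    have [w1 w2] := wm _ ik.
    have [e1 e2] := weven i im;
      rewrite -e1 -e2 -(step2_even i) w2 step1_even //.
    by split=> //; case: w1 => //; lia.
  have odd i : (1 <= i < m)%N ->
      (r i.*2 = d i.*2.+1 - r i.*2.+1 /\ top_rank i.+1 = d i.*2.+1 - q i)%N.
    move=> im; have i0 : (0 < i)%N by case/andP: im.
    have ik : (1 <= i.*2.+1 <= k.*2.+1)%N by lia.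
    have [w1 w2] := wm _ ik.
    have [e1 e2] := wodd i im; rewrite -e1 -e2 -step2_odd w2 step1_odd //.
    by split=> //; case: w1 => //; lia.
  (* As [top_rank i] is p_i for i < m, the equations at 2i and 2i+1 carry the value d_1 from i to
     i+1, up to [top_rank m] = d_(2m). *)
  have top i : (1 <= i <= m)%N -> top_rank i = d 1%N.
    elim: i => // i IH im; have [->|i0] := posnP i; first exact: top1.
    have im' : (1 <= i < m)%N by lia.
    have [_ ->] := odd i im'; have [-> _] := even i im'.
    by rewrite -IH; [rewrite /top_rank; case: eqP im'; lia | lia].
  have pE i : (1 <= i < m)%N -> p i = d 1%N.
    by move=> im; rewrite -(top i); [rewrite /top_rank; case: eqP im;
      lia | lia].
  split=> // [|i im|i im].
  - by rewrite -(top m) /top_rank ?eqxx //; lia.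
  - have [e1 _] := even i im; have := rank_ker im; rewrite -(pE i im); lia.
  (* The relation for r_i comes from the vertex i+1, which is even or odd according to the parity of
     i. *)
  - have := odd_double_half i; case: (ssrnat.odd i) => /= iE.
      have jm : (1 <= i./2.+1 < m)%N by lia.
      have [_ e] := even _ jm; have [h1 _ h2 _] := rank_even jm.
      have jE : i./2.+1.*2 = i.+1 by lia.
      by rewrite jE /= in e h1 h2; lia.
    have jm : (1 <= i./2 < m)%N by lia.
    have [e _] := odd _ jm; have h := rank_odd_succ jm.
    have jE : i./2.*2 = i by lia.
    by rewrite jE in e h; lia.
have top i : (1 <= i <= m)%N -> top_rank i = d 1%N.
  by move=> im; rewrite /top_rank; case: eqP => [_|?]; [rewrite dE | apply: pE;
    lia].
apply: (vertex_cases (P := fun j => (j = 1%N \/ weight1 j = step2 d r p j)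
  /\ weight2 j = (d j - step1 r q j)%N)) => [|i im|i im].
- split; first by left.
  by rewrite -[LHS]/(top_rank 1) top // subn0.
- have i0 : (0 < i)%N by case/andP: im.
  have [-> ->] := weven i im; rewrite step1_even // step2_even.
  have := rE i.*2.-1; rewrite prednK ?double_gt0 // => /(_ _) e.
  have := qE i im; have := pE i im; have := rank_ker im.
  by split; [right|]; lia.
- have i0 : (0 < i)%N by case/andP: im.
  have [-> ->] := wodd i im; rewrite step1_odd // step2_odd.
  have := rE i.*2; have := qE i im; have := rank_ker im;
    have := rank_odd_succ im.
  have := top i.+1; case/andP: im => _ im /(_ im).
  by split; [right|]; lia.
Qed.

End Quiver.

(** [proper_flags] supplies, across every step of every flag, the two vectors whose transposition
    determines the exponents in the forward implication. *)
Theorem proposition3p18 (R : realType) (m : nat) (d r p q : nat -> nat)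
    (phi : quiver_rep R[i] d) :
  (0 < m)%N ->
  has_ranks m r p q phi ->
  (forall i : nat, (1 <= i < m)%N -> p i <> r i.*2.-1 /\ p i <> r i.*2) ->
  (forall i : nat, (1 <= i < m)%N ->
     ((q i)%:Z <> (d i.*2.+1)%:Z - (r i.*2.+1)%:Z)%R /\
     ((q i)%:Z <> (d i.*2.+1)%:Z - (r i.*2)%:Z)%R) ->
  let conditions :=
    [/\ d 1%N = d m.*2,
        forall i : nat, (1 <= i < m)%N -> p i = d 1%N,
        forall i : nat, (1 <= i < m)%N ->
          ((q i)%:Z = (d i.*2.+1)%:Z - (d 1%N)%:Z)%R
      & forall i : nat, (1 <= i <= m.*2 - 2)%N ->
          ((r i)%:Z = (d i.+1)%:Z - (r i.+1)%:Z)%R] in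
  (proper_flags m d r p q ->
     (crepant R[i] m d r p q <-> conditions)) /\
  (conditions -> crepant R[i] m d r p q).
Proof.
case: m => // k _ hphi hp hq conditions.
have matchP : weights_match k d r p q <-> conditions := weights_matchP hphi.
have crepant_of : conditions -> crepant R[i] k.+1 d r p q.
  by move/matchP; exact: weights_match_crepant hphi.
split=> // proper; split=> // cr; apply/matchP.
exact: crepant_weights_match hphi hp hq proper cr.
Qed.
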